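(* Let $\mathcal{A}$ be any first-order structure with universe $U_{\mathcal{A}}$, and let $Q\subseteq U_{\mathcal{A}}^\infty$ with $Q\in \mathrm{SDEC}_{\mathcal{A}}$. Then $(\mathrm{SDEC}_{\mathcal{A}}^\nu)^Q\subseteq \mathrm{SDEC}_{\mathcal{A}}^{\mathrm{ND}}$.
   Context: A first-order structure $\mathcal{A}=(U_{\mathcal{A}};(c_i)_{i};(f_i)_{i};(r_i)_{i})$ has a universe, constants, functions $f_i$ of arity $m_i$ and relations $r_i$ of arity $k_i$ (the identity relation need not be among them). $U_{\mathcal{A}}^\infty=\bigcup_{n\ge1}U_{\mathcal{A}}^n$. A (deterministic) BSS RAM $\mathcal{M}$ over $\mathcal{A}$ has $Z$-registers $Z_1,Z_2,\dots$ (holding elements of $U_{\mathcal{A}}$), finitely many index registers $I_1,\dots,I_{k}$ (holding positive integers), and a program: a finite sequence of labeled instructions $1,\dots,\ell_{\mathcal P}$, the last being the only stop instruction, each of one of the types: $Z_j:=f_i(Z_{j_1},\dots,Z_{j_{m_i}})$; $Z_j:=c_i$; $Z_{I_j}:=Z_{I_k}$ (copy between registers addressed by index registers); if $r_i(Z_{j_1},\dots,Z_{j_{k_i}})$ then goto $\ell_1$ else goto $\ell_2$; if $I_j=I_k$ then goto $\ell_1$ else goto $\ell_2$; $I_j:=1$; $I_j:=I_j+1$; stop. A configuration is $(\ell,\nu_1,\dots,\nu_k,u_1,u_2,\dots)$ (label, index register contents, $Z$-register contents), transformed step by step in the obvious way. On input $\vec x=(x_1,\dots,x_n)\in U_{\mathcal{A}}^\infty$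 the initial configuration is $(1,(n,1,\dots,1),(x_1,\dots,x_n,x_n,x_n,\dots))$; when the stop label is reached the output is $(u_1,\dots,u_{\nu_1})$. The halting set of a machine is the set of inputs on which it halts (for nondeterministic machines: on which at least one computation halts). $\mathrm{SDEC}_{\mathcal{A}}$ is the class of halting sets of deterministic BSS RAMs over $\mathcal{A}$ (the semi-decidable sets). A non-deterministic BSS RAM over $\mathcal{A}$ is like a deterministic one except that on input $\vec x$ every configuration $(1,(n,1,\dots,1),(x_1,\dots,x_n,y_1,\dots,y_m,x_n,x_n,\dots))$ with $m\ge1$ and arbitrary guesses $(y_1,\dots,y_m)\in U_{\mathcal{A}}^m$ is an admissible initial configuration. $\mathrm{SDEC}_{\mathcal{A}}^{\mathrm{ND}}$ is the class of halting sets of such machines. For $Q\subseteq U_{\mathcal{A}}^\infty$ and $\vec z\in U_{\mathcal{A}}^\infty$, Moschovakis' operator is $\nu[Q](\vec z)=\{y_1\in U_{\mathcal{A}}\mid \exists m\ge1\ \exists y_2,\dots,y_m\in U_{\mathcal{A}}:\ (\vec z,y_1,\dots,y_m)\in Q\}$. A $\nu$-oracle BSS RAM over $\mathcal{A}$ with oracle $Q$ is a deterministic-style BSS RAM (deterministic input procedure) that may additionally use instructions $Z_j:=\nu[Q](Z_1,\dots,Z_{I_1})$: executing it in a configuration with $Z$-contents $u_1,u_2,\dots$ and $I_1$-content $\nu_1$ sets $Z_j$ to an arbitrarily chosen element of $\nu[Q](u_1,\dots,u_{\nu_1})$ (non-deterministic choice), and if this set is empty the machine loops forever. $(\mathrm{SDEC}_{\mathcal{A}}^\nu)^Q$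 is the class of halting sets (inputs with at least one halting computation) of $\nu$-oracle BSS RAMs over $\mathcal{A}$ with oracle $Q$. *)

(* Defs.v *)
From Stdlib Require Import List Arith Relations.
Import ListNotations.

Set Implicit Arguments.

(* A first-order structure: universe, families of constants, functions
   (with arities) and relations (with arities).  An m-ary function is
   represented by a function on lists; only its values on lists of length
   m are ever used.  Relations are arbitrary (Prop-valued). *)
Record structure := mkStructure {
  U : Type;
  Cidx : Type; cst : Cidx -> U;
  Fidx : Type; farity : Fidx -> nat; fn : Fidx -> list U -> U;
  Ridx : Type; rarity : Ridx -> nat; rel : Ridx -> list U -> Prop }.

(* Instructions.  Z-register and index-register numbers and labels are
   1-based naturals; ranges are enforced by [wf] below. *)
Inductive instr (A : structure) : Type :=
| IFun   (j : nat) (i : Fidx A) (args : list nat)   (* Z_j := f_i(Z_args) *)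
| IConst (j : nat) (i : Cidx A)                     (* Z_j := c_i *)
| ICopy  (j k : nat)                                (* Z_{I_j} := Z_{I_k} *)
| IRel   (i : Ridx A) (args : list nat) (l1 l2 : nat)
                          (* if r_i(Z_args) then goto l1 else goto l2 *)
| IIdxEq (j k l1 l2 : nat)    (* if I_j = I_k then goto l1 else goto l2 *)
| ISet1  (j : nat)            (* I_j := 1 *)
| IIncr  (j : nat)            (* I_j := I_j + 1 *)
| IStop
| INu    (j : nat).           (* Z_j := nu[Q](Z_1,...,Z_{I_1})  (oracle) *)

Arguments IFun {A}. Arguments IConst {A}. Arguments ICopy {A}.
Arguments IRel {A}. Arguments IIdxEq {A}. Arguments ISet1 {A}.
Arguments IIncr {A}. Arguments INu {A}.

Record machine (A : structure) := mkMachine {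
  nidx : nat;
  prog : list (instr A) }.

Record config (A : structure) := mkConfig {
  lab  : nat;
  ireg : nat -> nat;
  zreg : nat -> U A }.

Definition upd {X : Type} (f : nat -> X) (j : nat) (v : X) : nat -> X :=
  fun i => if Nat.eqb i j then v else f i.

Definition nu_set {X : Type} (Q : list X -> Prop) (z : list X) (y1 : X) : Prop :=
  exists ys : list X, Q (z ++ y1 :: ys).

Definition zwindow {X : Type} (u : nat -> X) (n : nat) : list X :=
  map u (seq 1 n).

Definition label_ok (A : structure) (M : machine A) (l : nat) : Prop :=
  1 <= l <= length (prog M).

Definition ireg_ok (A : structure) (M : machine A) (j : nat) : Prop :=
  1 <= j <= nidx M.

Definition instr_ok (A : structure) (allow_nu : bool) (M : machine A)
  (ins : instr A) : Prop :=
  match ins with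
  | IFun j i args => 1 <= j /\ length args = @farity A i /\ Forall (fun a => 1 <= a) args
  | IConst j _ => 1 <= j
  | ICopy j k => ireg_ok M j /\ ireg_ok M k
  | IRel i args l1 l2 => length args = @rarity A i /\ Forall (fun a => 1 <= a) args
                         /\ label_ok M l1 /\ label_ok M l2
  | IIdxEq j k l1 l2 => ireg_ok M j /\ ireg_ok M k /\ label_ok M l1 /\ label_ok M l2
  | ISet1 j => ireg_ok M j
  | IIncr j => ireg_ok M j
  | IStop _ => True
  | INu j => allow_nu = true /\ 1 <= j
  end.

Definition wf (A : structure) (allow_nu : bool) (M : machine A) : Prop :=
  1 <= nidx M /\
  (exists p, prog M = p ++ [IStop A]) /\
  (forall l, nth_error (prog M) l = Some (IStop A) -> S l = length (prog M)) /\
  Forall (instr_ok allow_nu M) (prog M).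

(* One computation step; the oracle Q is used only by nu-instructions.
   If nu[Q](...) is empty the machine loops forever (stays in place). *)
Definition step (A : structure) (Q : list (U A) -> Prop) (M : machine A)
  (c c' : config A) : Prop :=
  1 <= lab c /\
  match nth_error (prog M) (lab c - 1) with
  | Some (IFun j i args) =>
      c' = @mkConfig A (S (lab c)) (ireg c) (upd (zreg c) j (fn A i (map (zreg c) args)))
  | Some (IConst j i) =>
      c' = @mkConfig A (S (lab c)) (ireg c) (upd (zreg c) j (cst A i))
  | Some (ICopy j k) =>
      c' = @mkConfig A (S (lab c)) (ireg c) (upd (zreg c) (ireg c j) (zreg c (ireg c k)))
  | Some (IRel i args l1 l2) =>
      (rel A i (map (zreg c) args) /\ c' = @mkConfig A l1 (ireg c) (zreg c)) \/
      (~ rel A i (map (zreg c) args) /\ c' = @mkConfig A l2 (ireg c) (zreg c))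
  | Some (IIdxEq j k l1 l2) =>
      c' = @mkConfig A (if Nat.eqb (ireg c j) (ireg c k) then l1 else l2) (ireg c) (zreg c)
  | Some (ISet1 j) =>
      c' = @mkConfig A (S (lab c)) (upd (ireg c) j 1) (zreg c)
  | Some (IIncr j) =>
      c' = @mkConfig A (S (lab c)) (upd (ireg c) j (S (ireg c j))) (zreg c)
  | Some (IStop _) => False
  | Some (INu j) =>
      (exists y, nu_set Q (zwindow (zreg c) (ireg c 1)) y /\
                 c' = @mkConfig A (S (lab c)) (ireg c) (upd (zreg c) j y)) \/
      ((forall y, ~ nu_set Q (zwindow (zreg c) (ireg c 1)) y) /\ c' = c)
  | None => False
  end.

Definition halts (A : structure) (Q : list (U A) -> Prop) (M : machine A)
  (c0 : config A) : Prop :=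
  exists c, clos_refl_trans _ (step Q M) c0 c /\ lab c = length (prog M).

Definition init_conf (A : structure) (n : nat) (tape : list (U A)) (dflt : U A)
  : config A :=
  @mkConfig A 1 (fun j => if Nat.eqb j 1 then n else 1) (fun i => nth (i - 1) tape dflt).

Definition noQ (A : structure) : list (U A) -> Prop := fun _ => False.

(* Halting sets (subsets of U^infty = nonempty tuples). *)
Definition HS_det (A : structure) (M : machine A) (x : list (U A)) : Prop :=
  exists x0 xs, x = x0 :: xs /\
    halts (@noQ A) M (@init_conf A (length x) x (last x x0)).

Definition HS_nd (A : structure) (M : machine A) (x : list (U A)) : Prop :=
  exists x0 xs, x = x0 :: xs /\
    exists y0 ys, halts (@noQ A) M (@init_conf A (length x) (x ++ y0 :: ys) (last x x0)).

Definition HS_nu (A : structure) (Q : list (U A) -> Prop) (M : machine A)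
  (x : list (U A)) : Prop :=
  exists x0 xs, x = x0 :: xs /\
    halts Q M (@init_conf A (length x) x (last x x0)).

Definition SDEC (A : structure) (P : list (U A) -> Prop) : Prop :=
  exists M : machine A, wf false M /\ forall x, P x <-> HS_det M x.

Definition SDEC_ND (A : structure) (P : list (U A) -> Prop) : Prop :=
  exists M : machine A, wf false M /\ forall x, P x <-> HS_nd M x.

Definition SDEC_nu (A : structure) (Q : list (U A) -> Prop)
  (P : list (U A) -> Prop) : Prop :=
  exists M : machine A, wf true M /\ forall x, P x <-> HS_nu Q M x.

(* Main.v *)
From Stdlib Require Import List Arith Lia Relations Classical FunctionalExtensionality.
Require Import Defs.
Import ListNotations.

Set Implicit Arguments.
Local Arguments Nat.mul : simpl never.

(** A query [Z_j := nu[Q](z)] is answered by taking the next guess [y_1] and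
    looking, for [s = 1, 2, ...] and [m <= s], whether the machine for [Q]
    halts on [(z, y_1, ..., y_m)] within [s] steps.  The number [m] of
    relevant guesses cannot itself be guessed, since elements of an arbitrary
    structure carry no numerical information, but any successful [m] proves
    [y_1] to be in [nu[Q](z)], and if no [m] succeeds the search may run
    forever.  After a success in round [s] the next [s] guesses are considered
    used up.  Conversely, for a halting computation of the oracle machine one
    takes for every query a guess sequence whose successful round [s] is
    minimal; the search then ends exactly in round [s], so the sequences for
    the consecutive queries can be concatenated.

    The memories of the oracle machine and of the machine for [Q] and the
    guesses occupy the registers of the three residue classes modulo 3. *)

(** * Structured programs *)

Section Programs.
Context (A : structure).

(** Two features of the model shape the construction. Index registers can only be set to 1,
    incremented and compared, so addresses cannot be computed cheaply; hence the index registers of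
    a simulated machine directly hold scaled addresses, and each [ICopy] remains a single copy.
    Moreover, the machine for [Q] must be interrupted after a bounded number of steps, so its code
    cannot be inlined: it is interpreted one instruction at a time, with its label kept in an index
    register.

    Once the guesses are on the tape, the constructed machine is deterministic. It is therefore
    written in a deterministic command language, where a termination proof describes every
    execution. Soundness has to cover arbitrary register contents, also those behind the guesses,
    where $x_n$ stands. Completeness has to lay down all guesses in advance, although the search may
    succeed with another $m$ than the intended one; only the round $s$ can be controlled, which is
    why $s$ and not $m$ fixes how many guesses a query consumes. *)

Inductive cmd : Type :=
| CFun (j : nat) (i : Fidx A) (args : list nat)
| CConst (j : nat) (i : Cidx A)
| CCopy (j k : nat)
| CSet1 (j : nat)
| CIncr (j : nat)
| CSkip
| CSeq (c1 c2 : cmd)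
| CIfRel (i : Ridx A) (args : list nat) (c1 c2 : cmd)
| CIfEq (j k : nat) (c1 c2 : cmd)
| CWhileNe (j k : nat) (c : cmd).

Inductive exec : cmd -> (nat -> nat) -> (nat -> U A) -> (nat -> nat) -> (nat -> U A) -> Prop :=
| exec_fun j i args I Z :
    exec (CFun j i args) I Z I (upd Z j (fn A i (map Z args)))
| exec_const j i I Z : exec (CConst j i) I Z I (upd Z j (cst A i))
| exec_copy j k I Z : exec (CCopy j k) I Z I (upd Z (I j) (Z (I k)))
| exec_set1 j I Z : exec (CSet1 j) I Z (upd I j 1) Z
| exec_incr j I Z : exec (CIncr j) I Z (upd I j (S (I j))) Z
| exec_skip I Z : exec CSkip I Z I Z
| exec_seq c1 c2 I Z I1 Z1 I2 Z2 :
    exec c1 I Z I1 Z1 -> exec c2 I1 Z1 I2 Z2 -> exec (CSeq c1 c2) I Z I2 Z2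
| exec_rel_true i args c1 c2 I Z I' Z' :
    rel A i (map Z args) -> exec c1 I Z I' Z' -> exec (CIfRel i args c1 c2) I Z I' Z'
| exec_rel_false i args c1 c2 I Z I' Z' :
    ~ rel A i (map Z args) -> exec c2 I Z I' Z' -> exec (CIfRel i args c1 c2) I Z I' Z'
| exec_eq_true j k c1 c2 I Z I' Z' :
    I j = I k -> exec c1 I Z I' Z' -> exec (CIfEq j k c1 c2) I Z I' Z'
| exec_eq_false j k c1 c2 I Z I' Z' :
    I j <> I k -> exec c2 I Z I' Z' -> exec (CIfEq j k c1 c2) I Z I' Z'
| exec_while_stop j k c I Z : I j = I k -> exec (CWhileNe j k c) I Z I Z
| exec_while_next j k c I Z I1 Z1 I2 Z2 :
    I j <> I k -> exec c I Z I1 Z1 -> exec (CWhileNe j k c) I1 Z1 I2 Z2 ->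
    exec (CWhileNe j k c) I Z I2 Z2.

Lemma exec_det c I Z I1 Z1 I2 Z2 :
  exec c I Z I1 Z1 -> exec c I Z I2 Z2 -> I1 = I2 /\ Z1 = Z2.
Proof.
  intros H; revert I2 Z2; induction H; intros Ia Za H'; inversion H'; subst;
    try (split; reflexivity); try contradiction; auto.
  - edestruct IHexec1; eauto; subst. auto.
  - edestruct IHexec1; eauto; subst. auto.
Qed.

(** * Total correctness rules for commands *)

Definition wp (c : cmd) (I : nat -> nat) (Z : nat -> U A)
  (P : (nat -> nat) -> (nat -> U A) -> Prop) : Prop :=
  exists I' Z', exec c I Z I' Z' /\ P I' Z'.

(** By determinism a termination proof also describes any given execution, so a terminating command
    is analysed once and used in both directions of the final equivalence. *)
Lemma wp_exec c I Z I' Z' (P : (nat -> nat) -> (nat -> U A) -> Prop) :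
  exec c I Z I' Z' -> wp c I Z P -> P I' Z'.
Proof.
  intros H (I1 & Z1 & H1 & HP).
  destruct (exec_det H H1) as [-> ->]; exact HP.
Qed.

Lemma wp_mono c I Z (P P' : (nat -> nat) -> (nat -> U A) -> Prop) :
  wp c I Z P -> (forall I' Z', P I' Z' -> P' I' Z') -> wp c I Z P'.
Proof. intros (I1 & Z1 & H & HP) HPP; exists I1, Z1; auto. Qed.

Lemma wp_fun j i args I Z (P : (nat -> nat) -> (nat -> U A) -> Prop) :
  P I (upd Z j (fn A i (map Z args))) -> wp (CFun j i args) I Z P.
Proof. intros; do 2 eexists; split; [constructor | assumption]. Qed.

Lemma wp_const j i I Z (P : (nat -> nat) -> (nat -> U A) -> Prop) :
  P I (upd Z j (cst A i)) -> wp (CConst j i) I Z P.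
Proof. intros; do 2 eexists; split; [constructor | assumption]. Qed.

Lemma wp_copy j k I Z (P : (nat -> nat) -> (nat -> U A) -> Prop) :
  P I (upd Z (I j) (Z (I k))) -> wp (CCopy j k) I Z P.
Proof. intros; do 2 eexists; split; [constructor | assumption]. Qed.

Lemma wp_set1 j I Z (P : (nat -> nat) -> (nat -> U A) -> Prop) :
  P (upd I j 1) Z -> wp (CSet1 j) I Z P.
Proof. intros; do 2 eexists; split; [constructor | assumption]. Qed.

Lemma wp_incr j I Z (P : (nat -> nat) -> (nat -> U A) -> Prop) :
  P (upd I j (S (I j))) Z -> wp (CIncr j) I Z P.
Proof. intros; do 2 eexists; split; [constructor | assumption]. Qed.

Lemma wp_skip I Z (P : (nat -> nat) -> (nat -> U A) -> Prop) :
  P I Z -> wp CSkip I Z P.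
Proof. intros; do 2 eexists; split; [constructor | assumption]. Qed.

Lemma wp_seq c1 c2 I Z (P : (nat -> nat) -> (nat -> U A) -> Prop) :
  wp c1 I Z (fun I1 Z1 => wp c2 I1 Z1 P) -> wp (CSeq c1 c2) I Z P.
Proof.
  intros (I1 & Z1 & H1 & I2 & Z2 & H2 & HP).
  exists I2, Z2; split; [econstructor; eassumption | exact HP].
Qed.

Lemma wp_ifrel i args c1 c2 I Z (P : (nat -> nat) -> (nat -> U A) -> Prop) :
  (rel A i (map Z args) -> wp c1 I Z P) ->
  (~ rel A i (map Z args) -> wp c2 I Z P) -> wp (CIfRel i args c1 c2) I Z P.
Proof.
  intros H1 H2; destruct (classic (rel A i (map Z args))) as [r | r].
  - destruct (H1 r) as (I1 & Z1 & H & HP); exists I1, Z1; split; [constructor|]; auto.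
  - destruct (H2 r) as (I1 & Z1 & H & HP); exists I1, Z1; split; [apply exec_rel_false|]; auto.
Qed.

Lemma wp_ifeq j k c1 c2 I Z (P : (nat -> nat) -> (nat -> U A) -> Prop) :
  (I j = I k -> wp c1 I Z P) -> (I j <> I k -> wp c2 I Z P) ->
  wp (CIfEq j k c1 c2) I Z P.
Proof.
  intros H1 H2; destruct (Nat.eq_dec (I j) (I k)) as [e | e].
  - destruct (H1 e) as (I1 & Z1 & H & HP); exists I1, Z1; split; [constructor|]; auto.
  - destruct (H2 e) as (I1 & Z1 & H & HP); exists I1, Z1; split; [apply exec_eq_false|]; auto.
Qed.

Lemma wp_while_stop j k c I Z (P : (nat -> nat) -> (nat -> U A) -> Prop) :
  I j = I k -> P I Z -> wp (CWhileNe j k c) I Z P.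
Proof. intros; exists I, Z; split; [constructor|]; assumption. Qed.

Lemma wp_while_next j k c I Z (P : (nat -> nat) -> (nat -> U A) -> Prop) :
  I j <> I k -> wp c I Z (fun I1 Z1 => wp (CWhileNe j k c) I1 Z1 P) ->
  wp (CWhileNe j k c) I Z P.
Proof.
  intros Hne (I1 & Z1 & H1 & I2 & Z2 & H2 & HP).
  exists I2, Z2; split; [eapply exec_while_next; eassumption | exact HP].
Qed.

(** For loops whose number of rounds is known in advance: the index of the invariant counts the
    rounds and decides the guard. *)
Lemma wp_while_count j k c (inv : nat -> (nat -> nat) -> (nat -> U A) -> Prop) N :
  (forall n I Z, inv n I Z -> (I j = I k <-> n = N)) ->
  (forall n I Z, n < N -> inv n I Z -> wp c I Z (inv (S n))) ->
  forall I Z, inv 0 I Z -> wp (CWhileNe j k c) I Z (inv N).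
Proof.
  intros Hstop Hstep I Z H0.
  assert (G : forall d n I Z, n + d = N -> inv n I Z -> wp (CWhileNe j k c) I Z (inv N)).
  { induction d as [|d IH]; intros n I1 Z1 Hd Hn.
    - assert (n = N) by lia; subst n.
      apply wp_while_stop; [now apply (Hstop _ _ _ Hn) | exact Hn].
    - apply wp_while_next.
      + intros e; apply (Hstop _ _ _ Hn) in e; lia.
      + apply wp_mono with (1 := Hstep n I1 Z1 ltac:(lia) Hn).
        intros; apply IH with (S n); [lia | assumption]. }
  now apply G with (d := N) (n := 0).
Qed.

(** Partial correctness, for the oracle search and the main loop, which may both run forever. *)
Lemma exec_while_inv j k c (inv : (nat -> nat) -> (nat -> U A) -> Prop) :
  (forall I Z I' Z', I j <> I k -> inv I Z -> exec c I Z I' Z' -> inv I' Z') ->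
  forall I Z I' Z', exec (CWhileNe j k c) I Z I' Z' -> inv I Z -> inv I' Z' /\ I' j = I' k.
Proof.
  intros Hstep I Z I' Z' H.
  remember (CWhileNe j k c) as w eqn:Ew.
  induction H; inversion Ew; subst; intros; eauto.
Qed.

Lemma upd_same (X : Type) (f : nat -> X) j v : upd f j v j = v.
Proof. unfold upd; now rewrite Nat.eqb_refl. Qed.

Lemma upd_other (X : Type) (f : nat -> X) j v i : i <> j -> upd f j v i = f i.
Proof. unfold upd; intros H; now rewrite (proj2 (Nat.eqb_neq i j) H). Qed.

Lemma upd_upd (X : Type) (f : nat -> X) j v w : upd (upd f j v) j w = upd f j w.
Proof.
  extensionality i; unfold upd; now destruct (Nat.eqb i j).
Qed.

Lemma upd_id (X : Type) (f : nat -> X) j : upd f j (f j) = f.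
Proof.
  extensionality i; unfold upd; destruct (Nat.eqb_spec i j); congruence.
Qed.

(** * Derived commands on index registers *)

Fixpoint repeat_cmd (n : nat) (c : cmd) : cmd :=
  match n with 0 => CSkip | S n' => CSeq c (repeat_cmd n' c) end.

Lemma wp_repeat c (inv : nat -> (nat -> nat) -> (nat -> U A) -> Prop) N :
  (forall n I Z, n < N -> inv n I Z -> wp c I Z (inv (S n))) ->
  forall I Z, inv 0 I Z -> wp (repeat_cmd N c) I Z (inv N).
Proof.
  intros Hstep I Z H0.
  assert (G : forall d n I Z, n + d = N -> inv n I Z -> wp (repeat_cmd d c) I Z (inv N)).
  { induction d as [|d IH]; intros n I1 Z1 Hd Hn; simpl.
    - assert (n = N) by lia; subst n. now apply wp_skip.
    - apply wp_seq, wp_mono with (1 := Hstep n I1 Z1 ltac:(lia) Hn).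
      intros; apply IH with (S n); [lia | assumption]. }
  now apply G with (d := N) (n := 0).
Qed.

Definition add_const (j n : nat) : cmd := repeat_cmd n (CIncr j).

Lemma wp_add_const j n I Z (P : (nat -> nat) -> (nat -> U A) -> Prop) :
  P (upd I j (I j + n)) Z -> wp (add_const j n) I Z P.
Proof.
  intros H; unfold add_const.
  apply wp_mono with (P := fun I' Z' => I' = upd I j (I j + n) /\ Z' = Z).
  2: { intros ? ? [-> ->]; exact H. }
  apply wp_repeat with (inv := fun k I' Z' => I' = upd I j (I j + k) /\ Z' = Z).
  - intros k I' Z' _ [-> ->]; apply wp_incr.
    rewrite upd_same, upd_upd; split; [f_equal; lia | reflexivity].
  - rewrite Nat.add_0_r, upd_id; auto.
Qed.

Definition set_const (j v : nat) : cmd := CSeq (CSet1 j) (add_const j (v - 1)).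

Lemma wp_set_const j v I Z (P : (nat -> nat) -> (nat -> U A) -> Prop) :
  1 <= v -> P (upd I j v) Z -> wp (set_const j v) I Z P.
Proof.
  intros Hv H; apply wp_seq, wp_set1, wp_add_const.
  rewrite upd_same, upd_upd; replace (1 + (v - 1)) with v by lia; exact H.
Qed.

(** The model has no assignment between index registers. Counting up from 1 reaches the target value
    because it is positive. *)
Definition copy_index (j k : nat) : cmd := CSeq (CSet1 j) (CWhileNe j k (CIncr j)).

Lemma wp_copy_index j k I Z (P : (nat -> nat) -> (nat -> U A) -> Prop) :
  j <> k -> 1 <= I k -> P (upd I j (I k)) Z -> wp (copy_index j k) I Z P.
Proof.
  intros Hjk Hk H; apply wp_seq, wp_set1.
  apply wp_mono with (P := fun I' Z' => I' = upd I j (1 + (I k - 1)) /\ Z' = Z).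
  2: { intros ? ? [-> ->]; replace (1 + (I k - 1)) with (I k) by lia; exact H. }
  apply wp_while_count
    with (inv := fun n I' Z' => I' = upd I j (1 + n) /\ Z' = Z).
  - intros n I' Z' [-> ->]; rewrite upd_same, upd_other by auto; lia.
  - intros n I' Z' _ [-> ->]; apply wp_incr.
    rewrite upd_same, upd_upd; split; [f_equal; lia | reflexivity].
  - auto.
Qed.

(** * Compilation to BSS RAMs *)

Fixpoint csize (c : cmd) : nat :=
  match c with
  | CSkip => 0
  | CSeq c1 c2 => csize c1 + csize c2
  | CIfRel _ _ c1 c2 | CIfEq _ _ c1 c2 => 2 + csize c1 + csize c2
  | CWhileNe _ _ c => 2 + csize c
  | _ => 1
  end.

(** Comparing $I_1$ with itself replaces the missing unconditional jump; every well-formed machine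
    has this register. *)
Definition goto (l : nat) : instr A := IIdxEq 1 1 l l.

(* [b] is the label of the first instruction of the compiled code. *)
Fixpoint compile (b : nat) (c : cmd) : list (instr A) :=
  match c with
  | CFun j i args => [IFun j i args]
  | CConst j i => [IConst j i]
  | CCopy j k => [ICopy j k]
  | CSet1 j => [ISet1 j]
  | CIncr j => [IIncr j]
  | CSkip => []
  | CSeq c1 c2 => compile b c1 ++ compile (b + csize c1) c2
  | CIfRel i args c1 c2 =>
      IRel i args (b + 1) (b + 2 + csize c1) ::
      compile (b + 1) c1 ++ goto (b + 2 + csize c1 + csize c2) ::
      compile (b + 2 + csize c1) c2
  | CIfEq j k c1 c2 =>
      IIdxEq j k (b + 1) (b + 2 + csize c1) ::
      compile (b + 1) c1 ++ goto (b + 2 + csize c1 + csize c2) ::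
      compile (b + 2 + csize c1) c2
  | CWhileNe j k c =>
      IIdxEq j k (b + 2 + csize c) (b + 1) :: compile (b + 1) c ++ [goto b]
  end.

Lemma compile_length c : forall b, length (compile b c) = csize c.
Proof.
  induction c; intros b; simpl; rewrite ?length_app; simpl; rewrite ?length_app, ?IHc, ?IHc1, ?IHc2;
    simpl; lia.
Qed.

Definition fetch (M : machine A) (l : nat) : option (instr A) := nth_error (prog M) (l - 1).

(** Code placement in terms of [fetch], so that the placement of a subcommand is a mere conjunct;
    list positions are dealt with once, in [code_at_compile]. *)
Fixpoint code_at (M : machine A) (b : nat) (c : cmd) : Prop :=
  match c with
  | CFun j i args => fetch M b = Some (IFun j i args)
  | CConst j i => fetch M b = Some (IConst j i)
  | CCopy j k => fetch M b = Some (ICopy j k)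
  | CSet1 j => fetch M b = Some (ISet1 j)
  | CIncr j => fetch M b = Some (IIncr j)
  | CSkip => True
  | CSeq c1 c2 => code_at M b c1 /\ code_at M (b + csize c1) c2
  | CIfRel i args c1 c2 =>
      fetch M b = Some (IRel i args (b + 1) (b + 2 + csize c1)) /\
      code_at M (b + 1) c1 /\
      fetch M (b + 1 + csize c1) = Some (goto (b + 2 + csize c1 + csize c2)) /\
      code_at M (b + 2 + csize c1) c2
  | CIfEq j k c1 c2 =>
      fetch M b = Some (IIdxEq j k (b + 1) (b + 2 + csize c1)) /\
      code_at M (b + 1) c1 /\
      fetch M (b + 1 + csize c1) = Some (goto (b + 2 + csize c1 + csize c2)) /\
      code_at M (b + 2 + csize c1) c2
  | CWhileNe j k c =>
      fetch M b = Some (IIdxEq j k (b + 2 + csize c) (b + 1)) /\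
      code_at M (b + 1) c /\ fetch M (b + 1 + csize c) = Some (goto b)
  end.

Lemma fetch_app (M : machine A) pre ins post b :
  prog M = pre ++ ins :: post -> b = S (length pre) -> fetch M b = Some ins.
Proof.
  intros Hp ->; unfold fetch; rewrite Hp; simpl.
  rewrite Nat.sub_0_r, nth_error_app2, Nat.sub_diag by lia; reflexivity.
Qed.

Lemma code_at_compile M c : forall pre post b,
  prog M = pre ++ compile b c ++ post -> b = S (length pre) -> code_at M b c.
Proof.
  induction c; intros pre post b Hp Hb; simpl in *;
    try (eapply fetch_app; eassumption); auto.
  - rewrite <- app_assoc in Hp. split.
    + eapply IHc1; eauto.
    + apply IHc2 with (pre := pre ++ compile b c1) (post := post).
      * now rewrite Hp, <- app_assoc.
      * rewrite length_app, compile_length; lia.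
  - rewrite <- app_assoc in Hp; simpl in Hp. repeat split.
    + eapply fetch_app; eauto.
    + eapply IHc1 with (pre := pre ++ [_]).
      * rewrite <- app_assoc; simpl; exact Hp.
      * rewrite length_app; simpl; lia.
    + eapply fetch_app with (pre := pre ++ _ :: compile (b + 1) c1).
      * rewrite <- app_assoc; simpl; exact Hp.
      * rewrite length_app; simpl; rewrite compile_length; lia.
    + eapply IHc2 with (pre := pre ++ _ :: compile (b + 1) c1 ++ [_]).
      * rewrite <- app_assoc; simpl; rewrite <- app_assoc; simpl; exact Hp.
      * rewrite length_app; simpl; rewrite length_app, compile_length; simpl; lia.
  - rewrite <- app_assoc in Hp; simpl in Hp. repeat split.
    + eapply fetch_app; eauto.
    + eapply IHc1 with (pre := pre ++ [_]).
      * rewrite <- app_assoc; simpl; exact Hp.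
      * rewrite length_app; simpl; lia.
    + eapply fetch_app with (pre := pre ++ _ :: compile (b + 1) c1).
      * rewrite <- app_assoc; simpl; exact Hp.
      * rewrite length_app; simpl; rewrite compile_length; lia.
    + eapply IHc2 with (pre := pre ++ _ :: compile (b + 1) c1 ++ [_]).
      * rewrite <- app_assoc; simpl; rewrite <- app_assoc; simpl; exact Hp.
      * rewrite length_app; simpl; rewrite length_app, compile_length; simpl; lia.
  - rewrite <- app_assoc in Hp; simpl in Hp. repeat split.
    + eapply fetch_app; eauto.
    + eapply IHc with (pre := pre ++ [_]).
      * rewrite <- app_assoc; simpl; exact Hp.
      * rewrite length_app; simpl; lia.
    + eapply fetch_app with (pre := pre ++ _ :: compile (b + 1) c).
      * rewrite <- app_assoc; simpl; exact Hp.
      * rewrite length_app; simpl; rewrite compile_length; lia.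
Qed.

(** * Correctness of the compiled code *)

Section CompilerCorrectness.
Context (Q : list (U A) -> Prop) (M : machine A).

Lemma step_fetch l I Z ins c' :
  1 <= l -> fetch M l = Some ins ->
  step Q M (@mkConfig A l I Z) c' <->
  match ins with
  | IFun j i args => c' = @mkConfig A (S l) I (upd Z j (fn A i (map Z args)))
  | IConst j i => c' = @mkConfig A (S l) I (upd Z j (cst A i))
  | ICopy j k => c' = @mkConfig A (S l) I (upd Z (I j) (Z (I k)))
  | IRel i args l1 l2 =>
      (rel A i (map Z args) /\ c' = @mkConfig A l1 I Z) \/
      (~ rel A i (map Z args) /\ c' = @mkConfig A l2 I Z)
  | IIdxEq j k l1 l2 => c' = @mkConfig A (if Nat.eqb (I j) (I k) then l1 else l2) I Z
  | ISet1 j => c' = @mkConfig A (S l) (upd I j 1) Z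
  | IIncr j => c' = @mkConfig A (S l) (upd I j (S (I j))) Z
  | IStop _ => False
  | INu j =>
      (exists y, nu_set Q (zwindow Z (I 1)) y /\
                 c' = @mkConfig A (S l) I (upd Z j y)) \/
      ((forall y, ~ nu_set Q (zwindow Z (I 1)) y) /\ c' = @mkConfig A l I Z)
  end.
Proof.
  intros Hl Hf; unfold step, fetch in *; simpl; rewrite Hf; destruct ins; tauto.
Qed.

Lemma step_goto l l' I Z c' :
  1 <= l -> fetch M l = Some (goto l') ->
  step Q M (@mkConfig A l I Z) c' <-> c' = @mkConfig A l' I Z.
Proof.
  intros Hl Hf; rewrite (step_fetch _ _ _ Hl Hf); simpl.
  now rewrite Nat.eqb_refl.
Qed.

Lemma exec_run c I Z I' Z' : exec c I Z I' Z' -> forall b, 1 <= b -> code_at M b c ->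
  clos_refl_trans _ (step Q M) (@mkConfig A b I Z) (@mkConfig A (b + csize c) I' Z').
Proof.
  induction 1; intros b Hb Hc; simpl in Hc |- *;
    try (apply rt_step; rewrite (step_fetch _ _ _ Hb Hc); rewrite Nat.add_1_r; reflexivity).
  - rewrite Nat.add_0_r; apply rt_refl.
  - destruct Hc as [Hc1 Hc2]. eapply rt_trans; [now apply IHexec1|].
    rewrite Nat.add_assoc. apply IHexec2; auto; lia.
  - destruct Hc as (Hf & Hc1 & Hg & Hc2).
    eapply rt_trans; [apply rt_step; rewrite (step_fetch _ _ _ Hb Hf); left; split; [assumption | reflexivity]|].
    eapply rt_trans; [apply IHexec; [lia | assumption]|].
    apply rt_step. rewrite step_goto; [|lia|eassumption]. f_equal; lia.
  - destruct Hc as (Hf & Hc1 & Hg & Hc2).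
    eapply rt_trans; [apply rt_step; rewrite (step_fetch _ _ _ Hb Hf); right; split; [assumption | reflexivity]|].
    replace (b + S (S (csize c1 + csize c2))) with (b + 2 + csize c1 + csize c2) by lia.
    apply IHexec; [lia | assumption].
  - destruct Hc as (Hf & Hc1 & Hg & Hc2).
    eapply rt_trans; [apply rt_step; rewrite (step_fetch _ _ _ Hb Hf), (proj2 (Nat.eqb_eq _ _) H); reflexivity|].
    eapply rt_trans; [apply IHexec; [lia | assumption]|].
    apply rt_step. rewrite step_goto; [|lia|eassumption]. f_equal; lia.
  - destruct Hc as (Hf & Hc1 & Hg & Hc2).
    eapply rt_trans; [apply rt_step; rewrite (step_fetch _ _ _ Hb Hf), (proj2 (Nat.eqb_neq _ _) H); reflexivity|].
    replace (b + S (S (csize c1 + csize c2))) with (b + 2 + csize c1 + csize c2) by lia.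
    apply IHexec; [lia | assumption].
  - destruct Hc as (Hf & Hc1 & Hg).
    apply rt_step; rewrite (step_fetch _ _ _ Hb Hf), (proj2 (Nat.eqb_eq _ _) H). f_equal; lia.
  - pose proof Hc as Hw. destruct Hc as (Hf & Hc1 & Hg).
    eapply rt_trans; [apply rt_step; rewrite (step_fetch _ _ _ Hb Hf), (proj2 (Nat.eqb_neq _ _) H); reflexivity|].
    eapply rt_trans; [apply IHexec1; [lia | assumption]|].
    eapply rt_trans; [|apply IHexec2; assumption].
    apply rt_step. rewrite step_goto; [|lia|eassumption]. reflexivity.
Qed.

Inductive nsteps : nat -> config A -> config A -> Prop :=
| nsteps_0 c : nsteps 0 c c
| nsteps_S n c c1 c2 : step Q M c c1 -> nsteps n c1 c2 -> nsteps (S n) c c2.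

Lemma nsteps_of_run c c' : clos_refl_trans _ (step Q M) c c' -> exists n, nsteps n c c'.
Proof.
  intros H; apply clos_rt_rt1n in H; induction H as [|c c1 c2 H1 _ [n IH]].
  - exists 0; constructor.
  - exists (S n); econstructor; eassumption.
Qed.

Lemma run_of_nsteps n c c' : nsteps n c c' -> clos_refl_trans _ (step Q M) c c'.
Proof.
  induction 1; [apply rt_refl | eapply rt_trans; [apply rt_step|]; eassumption].
Qed.

Lemma nsteps_inv n c c' :
  nsteps n c c' -> lab c < lab c' ->
  exists n' c1, n = S n' /\ step Q M c c1 /\ nsteps n' c1 c'.
Proof. intros H Hl; inversion H; subst; [lia | eauto]. Qed.

(** Jumps inside the code stay between [b] and the exit label [b + csize c], so a run ending at or
    beyond the exit label must pass through it. The bound [n' <= n] serves the loop case, an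
    induction on the length of the run. *)
Lemma run_exec c : forall b n I Z cf,
  1 <= b -> code_at M b c -> nsteps n (@mkConfig A b I Z) cf -> b + csize c <= lab cf ->
  exists n' I' Z', n' <= n /\ exec c I Z I' Z' /\ nsteps n' (@mkConfig A (b + csize c) I' Z') cf.
Proof.
  induction c; intros b n I Z cf Hb Hc Hn Hl; simpl in Hc, Hl |- *.
  1-5: destruct (nsteps_inv Hn) as (n' & c1 & -> & Hs & Hn'); [simpl; lia|];
    rewrite (step_fetch _ _ _ Hb Hc) in Hs; subst c1;
    rewrite Nat.add_1_r; do 3 eexists; repeat split; [| constructor | eassumption]; lia.
  - rewrite Nat.add_0_r; do 3 eexists; repeat split; [| constructor | eassumption]; lia.
  - destruct Hc as [Hc1 Hc2].
    destruct (IHc1 b n I Z cf) as (n1 & I1 & Z1 & Hle1 & He1 & Hn1); auto; [lia|].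
    destruct (IHc2 (b + csize c1) n1 I1 Z1 cf) as (n2 & I2 & Z2 & Hle2 & He2 & Hn2); auto; try lia.
    exists n2, I2, Z2; split; [lia | split]; [econstructor; eassumption|].
    now rewrite Nat.add_assoc.
  - destruct Hc as (Hf & Hc1 & Hg & Hc2).
    destruct (nsteps_inv Hn) as (n' & c0 & -> & Hs & Hn'); [simpl; lia|].
    rewrite (step_fetch _ _ _ Hb Hf) in Hs.
    replace (b + S (S (csize c1 + csize c2))) with (b + 2 + csize c1 + csize c2) in * by lia.
    destruct Hs as [[Hr ->] | [Hr ->]].
    + destruct (IHc1 (b + 1) n' I Z cf) as (n1 & I1 & Z1 & Hle1 & He1 & Hn1); auto; try lia.
      destruct (nsteps_inv Hn1) as (n2 & c0 & -> & Hs & Hn2); [simpl; lia|].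
      rewrite step_goto in Hs; [|lia|eassumption]. subst c0.
      exists n2, I1, Z1; split; [lia | split]; [now constructor | assumption].
    + destruct (IHc2 (b + 2 + csize c1) n' I Z cf) as (n1 & I1 & Z1 & Hle1 & He1 & Hn1); auto; try lia.
      exists n1, I1, Z1; split; [lia | split]; [now apply exec_rel_false | assumption].
  - destruct Hc as (Hf & Hc1 & Hg & Hc2).
    destruct (nsteps_inv Hn) as (n' & c0 & -> & Hs & Hn'); [simpl; lia|].
    rewrite (step_fetch _ _ _ Hb Hf) in Hs.
    replace (b + S (S (csize c1 + csize c2))) with (b + 2 + csize c1 + csize c2) in * by lia.
    destruct (Nat.eqb_spec (I j) (I k)) as [e | e]; subst c0.
    + destruct (IHc1 (b + 1) n' I Z cf) as (n1 & I1 & Z1 & Hle1 & He1 & Hn1); auto; try lia.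
      destruct (nsteps_inv Hn1) as (n2 & c0 & -> & Hs & Hn2); [simpl; lia|].
      rewrite step_goto in Hs; [|lia|eassumption]. subst c0.
      exists n2, I1, Z1; split; [lia | split]; [now constructor | assumption].
    + destruct (IHc2 (b + 2 + csize c1) n' I Z cf) as (n1 & I1 & Z1 & Hle1 & He1 & Hn1); auto; try lia.
      exists n1, I1, Z1; split; [lia | split]; [now apply exec_eq_false | assumption].
  - revert I Z Hn; induction n as [n IHn] using lt_wf_ind; intros I Z Hn.
    pose proof Hc as (Hf & Hc1 & Hg).
    destruct (nsteps_inv Hn) as (n' & c0 & -> & Hs & Hn'); [simpl; lia|].
    rewrite (step_fetch _ _ _ Hb Hf) in Hs.
    replace (b + S (S (csize c))) with (b + 2 + csize c) in * by lia.
    destruct (Nat.eqb_spec (I j) (I k)) as [e | e]; subst c0.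
    + exists n', I, Z; split; [lia | split]; [now constructor | assumption].
    + destruct (IHc (b + 1) n' I Z cf) as (n1 & I1 & Z1 & Hle1 & He1 & Hn1); auto; try lia.
      destruct (nsteps_inv Hn1) as (n2 & c0 & -> & Hs & Hn2); [simpl; lia|].
      rewrite step_goto in Hs; [|lia|eassumption]. subst c0.
      destruct (IHn n2) with (I := I1) (Z := Z1) as (n3 & I3 & Z3 & Hle3 & He3 & Hn3);
        auto; try lia.
      exists n3, I3, Z3; split; [lia | split]; [econstructor; eassumption | assumption].
Qed.

End CompilerCorrectness.

Fixpoint cmd_ok (k : nat) (c : cmd) : Prop :=
  match c with
  | CFun j i args => 1 <= j /\ length args = farity A i /\ Forall (fun a => 1 <= a) args
  | CConst j _ => 1 <= j
  | CCopy j l => 1 <= j <= k /\ 1 <= l <= k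
  | CSet1 j | CIncr j => 1 <= j <= k
  | CSkip => True
  | CSeq c1 c2 => cmd_ok k c1 /\ cmd_ok k c2
  | CIfRel i args c1 c2 =>
      length args = rarity A i /\ Forall (fun a => 1 <= a) args /\ cmd_ok k c1 /\ cmd_ok k c2
  | CIfEq j l c1 c2 => 1 <= j <= k /\ 1 <= l <= k /\ cmd_ok k c1 /\ cmd_ok k c2
  | CWhileNe j l c => 1 <= j <= k /\ 1 <= l <= k /\ cmd_ok k c
  end.

(** Branches and loops jump to the label right behind their code, so [b + csize c] itself must be a
    label; for the whole command it is that of the stop instruction. *)
Lemma compile_ok M c : 1 <= nidx M -> cmd_ok (nidx M) c ->
  forall b, 1 <= b -> b + csize c <= length (prog M) ->
  Forall (instr_ok false M) (compile b c).
Proof.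
  intros HM; induction c; intros Hok b Hb Hl; simpl in *;
    repeat (apply Forall_cons || apply Forall_nil || (apply Forall_app; split));
    simpl; unfold ireg_ok, label_ok; intuition (try lia).
  all: match goal with H : context [compile _ ?c] |- context [compile _ ?c] => apply H; lia end.
Qed.

Lemma compile_no_stop c b : ~ In (IStop A) (compile b c).
Proof.
  revert b; induction c; intros b; simpl; rewrite ?in_app_iff; simpl;
    rewrite ?in_app_iff; simpl; unfold goto; intuition (try discriminate); firstorder.
Qed.

Definition machine_of (k : nat) (c : cmd) : machine A :=
  mkMachine k (compile 1 c ++ [IStop A]).

Lemma machine_of_wf k c : 1 <= k -> cmd_ok k c -> wf false (machine_of k c).
Proof.
  intros Hk Hc; split; [exact Hk | split; [|split]]; simpl.
  - eauto.
  - intros l Hl; destruct (Nat.lt_ge_cases l (length (compile 1 c))) as [H | H].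
    + rewrite nth_error_app1 in Hl by exact H.
      apply nth_error_In in Hl; now apply compile_no_stop in Hl.
    + rewrite length_app; simpl.
      assert (nth_error (compile 1 c ++ [IStop A]) l <> None) as Hn by congruence.
      apply nth_error_Some in Hn; rewrite length_app in Hn; simpl in Hn; lia.
  - apply Forall_app; split.
    + apply compile_ok; simpl; auto.
      rewrite length_app, compile_length; simpl; lia.
    + repeat constructor.
Qed.

(** The stop instruction stands exactly at the exit label of [c], so labels of the constructed
    machine need not be mentioned again. The oracle is arbitrary because compiled code contains no
    query. *)
Lemma machine_of_halts Q k c I Z :
  halts Q (machine_of k c) (@mkConfig A 1 I Z) <-> exists I' Z', exec c I Z I' Z'.
Proof.
  assert (Hc : code_at (machine_of k c) 1 c)
    by (apply code_at_compile with (pre := []) (post := [IStop A]); reflexivity).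
  assert (Hl : length (prog (machine_of k c)) = 1 + csize c)
    by (simpl; rewrite length_app, compile_length; simpl; lia).
  unfold halts; rewrite Hl; split.
  - intros (cf & Hrun & Hlab).
    apply nsteps_of_run in Hrun as [n Hn].
    destruct (run_exec c (b := 1) ltac:(lia) Hc Hn ltac:(lia))
      as (_ & I' & Z' & _ & He & _); eauto.
  - intros (I' & Z' & He); eexists; split; [eapply exec_run; eauto | reflexivity].
Qed.

End Programs.

Ltac case_upd :=
  repeat match goal with
  | |- context [upd ?f ?j ?v ?i] =>
      first [ rewrite (upd_same f j v)
            | rewrite (upd_other f (j := j) v (i := i)) by (try lia; auto)
            | unfold upd at 1; destruct (Nat.eqb_spec i j); try lia; try subst ]
  end.

Section OkLemmas.
Context (A : structure) (k : nat).

Lemma repeat_cmd_ok n (c : cmd A) : cmd_ok k c -> cmd_ok k (repeat_cmd n c).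
Proof. intros H; induction n; simpl; auto. Qed.

Lemma add_const_ok j n : 1 <= j <= k -> cmd_ok k (add_const A j n).
Proof. intros H; now apply repeat_cmd_ok. Qed.

Lemma set_const_ok j v : 1 <= j <= k -> cmd_ok k (set_const A j v).
Proof. intros H; split; [exact H | now apply add_const_ok]. Qed.

Lemma copy_index_ok j l : 1 <= j <= k -> 1 <= l <= k -> cmd_ok k (copy_index A j l).
Proof. simpl; tauto. Qed.

End OkLemmas.

(** * Simulation of a machine inside a residue class of registers *)

(** Only register numbers written in an instruction have a static bound; registers reached through
    index registers are covered by the moving bound [h] of [simrel]. *)
Definition fixed_le (A : structure) (K : nat) (ins : instr A) : Prop :=
  match ins with
  | IFun j _ args => j <= K /\ Forall (fun a => a <= K) args
  | IConst j _ => j <= K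
  | IRel _ args _ _ => Forall (fun a => a <= K) args
  | INu j => j <= K
  | _ => True
  end.

Lemma Forall_le_weaken K K' l :
  K <= K' -> Forall (fun a => a <= K) l -> Forall (fun a => a <= K') l.
Proof. intros HK; apply Forall_impl; lia. Qed.

Lemma fixed_le_exists (A : structure) (p : list (instr A)) :
  exists K, Forall (fixed_le K) p.
Proof.
  induction p as [|ins p [K HK]]; [exists 0; constructor|].
  assert (Hl : forall l, exists K, Forall (fun a => a <= K) l).
  { intros l; exists (list_max l); now apply list_max_le. }
  assert (Hi : exists K', fixed_le K' ins).
  { destruct ins as [j i args | j i | j k | i args l1 l2 | j k l1 l2 | j | j | | j];
      try (exists 0; exact I); try (exists j; simpl; lia); destruct (Hl args) as [K' H'].
    - exists (j + K'); split; [lia|]. apply Forall_le_weaken with K'; [lia | exact H'].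
    - exists K'; exact H'. }
  destruct Hi as [K' HK']; exists (K + K').
  assert (G : forall K1 K2 (i : instr A), K1 <= K2 -> fixed_le K1 i -> fixed_le K2 i).
  { intros K1 K2 i HK12; destruct i; simpl; intuition (try lia);
      eauto using Forall_le_weaken. }
  constructor.
  - apply G with K'; [lia | exact HK'].
  - apply Forall_impl with (2 := HK); intros i; apply G; lia.
Qed.

(** A halted or stuck configuration repeats itself, so every interpreter pass on a non-query
    instruction is one [advance], and [s] passes decide halting within [s] steps. *)
Definition advance (A : structure) (Q : list (U A) -> Prop) (N : machine A)
  (c c' : config A) : Prop :=
  step Q N c c' \/ ((forall c1, ~ step Q N c c1) /\ c' = c).

Section Simulator.
Context (A : structure) (N : machine A) (r pc hr t off K : nat) (nu : nat -> cmd A).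
(* Register [Z_i] of [N] lives in register [3 * i + r], and the index registers
   hold the scaled addresses [3 * i + r].  Since unboundedly many registers of
   [N] start with the value [d], only those up to a bound [h], which is raised
   whenever an index register is incremented, are kept up to date; [d] itself
   is stored in register [r]. *)
Definition simrel (d : U A) (c : config A) (I : nat -> nat) (Z : nat -> U A) : Prop :=
  exists h, I pc = lab c /\ I hr = 3 * h + r /\ K <= h /\
    (forall j, 1 <= j <= nidx N -> I (off + j) = 3 * ireg c j + r /\ 1 <= ireg c j <= h) /\
    Z r = d /\
    (forall i, 1 <= i <= h -> Z (3 * i + r) = zreg c i) /\
    (forall i, h < i -> zreg c i = d).

Definition frame (I I' : nat -> nat) (Z Z' : nat -> U A) : Prop :=
  (forall x, x <> pc -> x <> hr -> x <> t -> x <= off \/ off + nidx N < x -> I' x = I x) /\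
  (forall a, (forall i, a <> 3 * i + r) -> Z' a = Z a).

Lemma simrel_ext d c I I' Z Z' :
  simrel d c I Z -> I' pc = I pc -> I' hr = I hr ->
  (forall j, 1 <= j <= nidx N -> I' (off + j) = I (off + j)) ->
  (forall i, Z' (3 * i + r) = Z (3 * i + r)) -> simrel d c I' Z'.
Proof.
  intros (h & H1 & H2 & H3 & H4 & H5 & H6 & H7) Ep Eh Ei Ez; exists h.
  rewrite Ep, Eh; repeat split; auto.
  - rewrite Ei by auto; now apply H4.
  - now apply H4.
  - now apply H4.
  - rewrite <- H5; exact (Ez 0).
  - intros i Hi; rewrite Ez; auto.
Qed.

Lemma simrel_goto d c I I' Z l :
  simrel d c I Z -> I' pc = l -> I' hr = I hr ->
  (forall j, 1 <= j <= nidx N -> I' (off + j) = I (off + j)) ->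
  simrel d (@mkConfig A l (ireg c) (zreg c)) I' Z.
Proof.
  intros (h & H1 & H2 & H3 & H4 & H5 & H6 & H7) Ep Eh Ei; exists h; simpl.
  rewrite Ep, Eh; repeat split; auto.
  - rewrite Ei by auto; now apply H4.
  - now apply H4.
  - now apply H4.
Qed.

Lemma simrel_write d c I I' Z Z' l i v :
  simrel d c I Z -> 1 <= i -> 3 * i + r <= I hr ->
  I' pc = l -> I' hr = I hr ->
  (forall j, 1 <= j <= nidx N -> I' (off + j) = I (off + j)) ->
  (forall k, Z' (3 * k + r) = upd Z (3 * i + r) v (3 * k + r)) ->
  simrel d (@mkConfig A l (ireg c) (upd (zreg c) i v)) I' Z'.
Proof.
  intros (h & H1 & H2 & H3 & H4 & H5 & H6 & H7) Hi1 Hih Ep Eh Ei Ez; exists h; simpl.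
  rewrite Ep, Eh; repeat split; auto.
  - rewrite Ei by auto; now apply H4.
  - now apply H4.
  - now apply H4.
  (* The register holding [d] has index 0 in its class, and a write to [i >= 1] misses it. *)
  - rewrite <- H5; change (Z' (3 * 0 + r) = Z r); rewrite Ez; now case_upd.
  - intros k Hk; rewrite Ez; destruct (Nat.eq_dec k i) as [->|]; case_upd; auto.
  - intros k Hk; rewrite upd_other by lia; auto.
Qed.

Lemma map_region d c I Z args :
  simrel d c I Z -> Forall (fun a => 1 <= a) args -> Forall (fun a => a <= K) args ->
  map Z (map (fun a => 3 * a + r) args) = map (zreg c) args.
Proof.
  intros (h & _ & _ & H3 & _ & _ & H6 & _) Ha Hb; rewrite map_map.
  apply map_ext_in; intros a Hin; rewrite Forall_forall in *.
  apply H6; split; [now apply Ha | specialize (Hb a Hin); lia].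
Qed.

Lemma simrel_hr d c I Z i : simrel d c I Z -> i <= K -> 3 * i + r <= I hr.
Proof. intros (h & H1 & H2 & H3 & _); lia. Qed.

Context (Hr : 1 <= r) (Hpc : 1 <= pc <= off) (Hhr : 1 <= hr <= off) (Ht : 1 <= t <= off)
  (Hpch : pc <> hr) (Hpct : pc <> t) (Hhrt : hr <> t).

(** [3 + r] is the address of register 1. Every index is at most [h], so raising [h] by one at each
    increment suffices; the register thus added receives [d] by a copy from address [r], put into
    [t], which [dispatch] no longer needs at that point. *)
Definition block (ins : instr A) : cmd A :=
  match ins with
  | IFun j i args =>
      CSeq (CFun A (3 * j + r) i (map (fun a => 3 * a + r) args)) (CIncr A pc)
  | IConst j i => CSeq (CConst A (3 * j + r) i) (CIncr A pc)
  | ICopy j k => CSeq (CCopy A (off + j) (off + k)) (CIncr A pc)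
  | IRel i args l1 l2 =>
      CIfRel i (map (fun a => 3 * a + r) args) (set_const A pc l1) (set_const A pc l2)
  | IIdxEq j k l1 l2 => CIfEq (off + j) (off + k) (set_const A pc l1) (set_const A pc l2)
  | ISet1 j => CSeq (set_const A (off + j) (3 + r)) (CIncr A pc)
  | IIncr j =>
      CSeq (add_const A (off + j) 3) (CSeq (add_const A hr 3)
        (CSeq (set_const A t r) (CSeq (CCopy A hr t) (CIncr A pc))))
  | IStop _ => CSkip A
  | INu j => CSeq (nu j) (CIncr A pc)
  end.

(** In place of a computed jump, the label in [pc] is compared with successive constants loaded into
    [t]. *)
Fixpoint dispatch (l : nat) (p : list (instr A)) : cmd A :=
  match p with
  | [] => CSkip A
  | ins :: p' => CSeq (set_const A t l) (CIfEq pc t (block ins) (dispatch (S l) p'))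
  end.

Definition simstep : cmd A := dispatch 1 (prog N).

Lemma exec_set_const_seq j v (c : cmd A) I Z I' Z' : 1 <= v ->
  exec (CSeq (set_const A j v) c) I Z I' Z' <-> exec c (upd I j v) Z I' Z'.
Proof.
  intros Hv.
  assert (H : exec (set_const A j v) I Z (upd I j v) Z).
  { destruct (@wp_set_const A j v I Z (fun I1 Z1 => I1 = upd I j v /\ Z1 = Z))
      as (I1 & Z1 & H1 & -> & ->); auto. }
  split.
  - inversion 1; subst.
    match goal with H1 : exec (set_const _ _ _) _ _ _ _ |- _ =>
      destruct (exec_det H H1); subst end; assumption.
  - intros; econstructor; eassumption.
Qed.

(** An equivalence of executions and not a [wp] rule, because the block of a query may diverge and
    is needed in both directions. *)
Lemma dispatch_hit p : forall l I Z ins,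
  1 <= l -> l <= I pc -> nth_error p (I pc - l) = Some ins ->
  forall I' Z', exec (dispatch l p) I Z I' Z' <-> exec (block ins) (upd I t (I pc)) Z I' Z'.
Proof.
  induction p as [|ins0 p IH]; intros l I Z ins H1 Hl Hn I' Z'.
  - destruct (I pc - l); discriminate.
  - simpl dispatch; rewrite exec_set_const_seq by exact H1.
    assert (Epc : upd I t l pc = I pc) by (apply upd_other; auto).
    destruct (Nat.eq_dec (I pc) l) as [e | e].
    + replace (I pc - l) with 0 in Hn by lia; injection Hn as <-; rewrite e.
      split.
      * inversion 1; subst; [assumption|]. rewrite Epc, upd_same in *; contradiction.
      * intros; apply exec_eq_true; [|assumption]. now rewrite Epc, upd_same.
    + replace (I pc - l) with (S (I pc - S l)) in Hn by lia; simpl in Hn.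
      rewrite <- (upd_upd I t l (I pc)), <- Epc at 1.
      rewrite <- (IH (S l)); [|lia|rewrite Epc; lia|rewrite Epc; exact Hn].
      split.
      * inversion 1; subst; [|assumption]. rewrite Epc, upd_same in *; contradiction.
      * intros; apply exec_eq_false; [|assumption]. now rewrite Epc, upd_same.
Qed.

Lemma dispatch_miss p : forall l I Z,
  1 <= l -> (l <= I pc -> nth_error p (I pc - l) = None) ->
  exists v, exec (dispatch l p) I Z (upd I t v) Z.
Proof.
  induction p as [|ins0 p IH]; intros l I Z H1 Hn.
  - exists (I t); rewrite upd_id; constructor.
  - assert (Epc : upd I t l pc = I pc) by (apply upd_other; auto).
    destruct (Nat.eq_dec (I pc) l) as [e | e].
    + replace (I pc - l) with 0 in Hn by lia; discriminate Hn; lia.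
    + destruct (IH (S l) (upd I t l) Z) as [v Hv]; [lia| |].
      * rewrite Epc; intros H. replace (I pc - l) with (S (I pc - S l)) in Hn by lia.
        apply Hn; lia.
      * exists v; simpl dispatch; rewrite exec_set_const_seq by exact H1.
        rewrite upd_upd in Hv.
        apply exec_eq_false; [now rewrite Epc, upd_same | exact Hv].
Qed.

Ltac frame_tac :=
  split; [intros x ? ? ? ?; case_upd; auto | intros a Ha; case_upd; auto;
    try (exfalso; eapply Ha; eassumption || reflexivity)].

Lemma block_sim Q d c I Z ins :
  simrel d c I Z -> 1 <= lab c -> fetch N (lab c) = Some ins ->
  ins <> IStop A -> (forall j, ins <> INu j) -> instr_ok true N ins -> fixed_le K ins ->
  wp (block ins) I Z (fun I' Z' =>
    exists c', step Q N c c' /\ simrel d c' I' Z' /\ frame I I' Z Z').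
Proof.
  intros HS Hl Hf Hstop Hnu Hok Hfix.
  pose proof HS as (h & H1 & H2 & H3 & H4 & H5 & H6 & H7).
  destruct c as [l ci cz]; simpl in *.
  assert (Hst := fun c' => @step_fetch A Q N l ci cz ins c' Hl Hf).
  destruct ins as [j i args | j i | j k | i args l1 l2 | j k l1 l2 | j | j | | j];
    simpl in Hst, Hok, Hfix |- *; try congruence.
  - destruct Hok as (Hj & _ & Hargs), Hfix as [HjK HargsK].
    apply wp_seq, wp_fun, wp_incr.
    eexists; split; [now apply Hst | split].
    + eapply simrel_write with (1 := HS); auto.
      * eapply simrel_hr; eassumption.
      * case_upd; auto.
      * case_upd; auto.
      * intros; case_upd; auto.
      * intros; rewrite (map_region HS) by assumption; reflexivity.
    + frame_tac.
  - apply wp_seq, wp_const, wp_incr.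
    eexists; split; [now apply Hst | split].
    + eapply simrel_write with (1 := HS); auto.
      * eapply simrel_hr; eassumption.
      * case_upd; auto.
      * case_upd; auto.
      * intros; case_upd; auto.
    + frame_tac.
  - destruct Hok as [Hj Hk].
    destruct (H4 j Hj) as [Ej Bj], (H4 k Hk) as [Ek Bk].
    apply wp_seq, wp_copy, wp_incr.
    eexists; split; [now apply Hst | split].
    + eapply simrel_write with (1 := HS); auto.
      * lia.
      * lia.
      * case_upd; auto.
      * case_upd; auto.
      * intros; case_upd; auto.
      * intros; rewrite Ej, Ek, H6 by lia; reflexivity.
    + rewrite Ej; frame_tac.
  - destruct Hok as (_ & Hargs & [Hl1 _] & [Hl2 _]).
    apply wp_ifrel; intros Hrel; apply wp_set_const; auto;
      rewrite (map_region HS) in Hrel by assumption.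
    + eexists; split; [apply Hst; left; split; [exact Hrel | reflexivity] | split].
      * eapply simrel_goto with (1 := HS); intros; case_upd; auto.
      * frame_tac.
    + eexists; split; [apply Hst; right; split; [exact Hrel | reflexivity] | split].
      * eapply simrel_goto with (1 := HS); intros; case_upd; auto.
      * frame_tac.
  - destruct Hok as (Hj & Hk & [Hl1 _] & [Hl2 _]).
    destruct (H4 j Hj) as [Ej Bj], (H4 k Hk) as [Ek Bk].
    apply wp_ifeq; intros He; apply wp_set_const; auto;
      (eexists; split; [apply Hst; reflexivity | split];
       [destruct (Nat.eqb_spec (ci j) (ci k)); [| ]; try (exfalso; lia);
        eapply simrel_goto with (1 := HS); intros; case_upd; auto | frame_tac]).
  - apply wp_seq, wp_set_const, wp_incr; [lia|].
    eexists; split; [now apply Hst | split].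
    + unfold ireg_ok in Hok.
      exists (h + 0); simpl; rewrite Nat.add_0_r; repeat split; auto.
      * case_upd; auto.
      * case_upd; auto.
      * destruct (Nat.eq_dec j0 j) as [->|]; case_upd; auto; now apply H4.
      * destruct (Nat.eq_dec j0 j) as [->|]; case_upd; auto; now apply H4.
      * destruct (Nat.eq_dec j0 j) as [->|]; case_upd; [|now apply H4].
        specialize (H4 j Hok); lia.
    + unfold ireg_ok in Hok; frame_tac.
  - unfold ireg_ok in Hok; destruct (H4 j Hok) as [Ej Bj].
    apply wp_seq, wp_add_const, wp_seq, wp_add_const, wp_seq, wp_set_const, wp_seq, wp_copy,
      wp_incr; auto.
    assert (Ehr : upd (upd (upd I (off + j) (I (off + j) + 3)) hr
              (upd I (off + j) (I (off + j) + 3) hr + 3)) t r hr = 3 * (h + 1) + r)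
      by (case_upd; lia).
    rewrite Ehr, upd_same, H5.
    eexists; split; [now apply Hst | split].
    + exists (h + 1); simpl; repeat split; auto.
      * case_upd; lia.
      * case_upd; lia.
      * lia.
      * destruct (Nat.eq_dec j0 j) as [->|]; case_upd; auto; [lia | now apply H4].
      * destruct (Nat.eq_dec j0 j) as [->|]; case_upd; auto; [lia | now apply H4].
      * destruct (Nat.eq_dec j0 j) as [->|]; case_upd; [lia|].
        destruct (H4 j0); auto; lia.
      * case_upd; auto.
      (* By the invariant the simulated register [h + 1], so far outside the bound, holds [d], the
         value just copied. *)
      * intros i Hi; destruct (Nat.eq_dec i (h + 1)) as [->|]; case_upd; auto.
        -- symmetry; apply H7; lia.
        -- apply H6; lia.
      * intros i Hi; apply H7; lia.
    + frame_tac.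
Qed.

Context (Hok : Forall (instr_ok true N) (prog N)) (HK : Forall (fixed_le K) (prog N)).

Lemma simrel_upd_t d c I Z v : simrel d c I Z -> simrel d c (upd I t v) Z.
Proof. intros H; eapply simrel_ext; eauto; intros; case_upd; auto. Qed.

Lemma simstep_plain Q d c I Z :
  simrel d c I Z -> (forall j, 1 <= lab c -> fetch N (lab c) <> Some (INu j)) ->
  wp simstep I Z (fun I' Z' =>
    exists c', advance Q N c c' /\ simrel d c' I' Z' /\ frame I I' Z Z').
Proof.
  intros HS Hnu; pose proof HS as (h & Epc & _).
  assert (Hidle : (lab c = 0 \/ fetch N (lab c) = None \/ fetch N (lab c) = Some (IStop A)) ->
                  forall c1, ~ step Q N c c1).
  { intros H c1 [Hl Hs]; unfold fetch in H.
    destruct H as [H | [H | H]]; [lia | |]; now rewrite H in Hs. }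
  assert (Hmiss : (lab c = 0 \/ fetch N (lab c) = None) -> wp simstep I Z (fun I' Z' =>
    exists c', advance Q N c c' /\ simrel d c' I' Z' /\ frame I I' Z Z')).
  { intros H; destruct (dispatch_miss (prog N) (l := 1) I Z) as [v Hv]; [lia | |].
    - rewrite Epc; intros; destruct H; [lia | assumption].
    - do 2 eexists; split; [exact Hv|]. exists c; split; [|split].
      + right; split; [apply Hidle; tauto | reflexivity].
      + now apply simrel_upd_t.
      + frame_tac. }
  destruct (Nat.eq_dec (lab c) 0) as [e | e]; [auto|].
  destruct (fetch N (lab c)) as [ins|] eqn:Hf; [clear Hmiss|auto].
  assert (Hhit := dispatch_hit (prog N) (l := 1) I Z (ins := ins)).
  rewrite Epc in Hhit; specialize (Hhit ltac:(lia) ltac:(lia) Hf).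
  assert (Hin : In ins (prog N)) by (eapply nth_error_In; exact Hf).
  destruct (classic (ins = IStop A)) as [-> | Hns].
  - exists (upd I t (lab c)), Z; split; [apply Hhit; constructor|].
    exists c; split; [|split].
    + right; split; [apply Hidle; tauto | reflexivity].
    + now apply simrel_upd_t.
    + frame_tac.
  - destruct (@block_sim Q d c (upd I t (lab c)) Z ins) as (I' & Z' & He & c' & Hst & Hs & HF1 & HF2);
      auto.
    + now apply simrel_upd_t.
    + lia.
    + intros j ->; apply (Hnu j); [lia | reflexivity].
    + rewrite Forall_forall in Hok; auto.
    + rewrite Forall_forall in HK; auto.
    + exists I', Z'; split; [now apply Hhit|].
      exists c'; split; [now left | split; [exact Hs|]].
      split; [|exact HF2].
      intros x ? ? ? ?; rewrite HF1, upd_other; auto.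
Qed.

Lemma simstep_nu d c I Z j I' Z' :
  simrel d c I Z -> 1 <= lab c -> fetch N (lab c) = Some (INu j) ->
  exec simstep I Z I' Z' <-> exec (CSeq (nu j) (CIncr A pc)) (upd I t (lab c)) Z I' Z'.
Proof.
  intros (h & Epc & _) Hl Hf.
  assert (Hhit := dispatch_hit (prog N) (l := 1) I Z (ins := INu j)).
  rewrite Epc in Hhit; exact (Hhit ltac:(lia) Hl Hf I' Z').
Qed.

(** * Initial configuration of a simulated machine *)

Fixpoint set_indices (k : nat) : cmd A :=
  match k with
  | 0 => CSkip A
  | S k' => CSeq (set_indices k') (set_const A (off + 2 + k') (3 + r))
  end.

Lemma wp_set_indices k I Z :
  wp (set_indices k) I Z (fun I' Z' => Z' = Z /\
    (forall x, x < off + 2 \/ off + 2 + k <= x -> I' x = I x) /\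
    (forall x, off + 2 <= x < off + 2 + k -> I' x = 3 + r)).
Proof.
  induction k as [|k IH]; simpl.
  - apply wp_skip; repeat split; auto; lia.
  - apply wp_seq, wp_mono with (1 := IH); intros I1 Z1 (-> & E1 & E2).
    apply wp_set_const; [lia|]; repeat split.
    + intros x Hx; rewrite upd_other by lia; apply E1; lia.
    + intros x Hx; destruct (Nat.eq_dec x (off + 2 + k)) as [->|];
        [apply upd_same | rewrite upd_other by auto; apply E2; lia].
Qed.

(** [src] contains the scaled address of the last input element. It provides the input length for
    $I_1$, the initial bound [h] and, read as an address, the value $x_n$ filling all further
    registers. The [K] repetitions raise the bound to at least [K]. *)
Definition setup (src : nat) : cmd A :=
  CSeq (set_const A t r) (CSeq (CCopy A t src) (CSeq (copy_index A (off + 1) src)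
    (CSeq (set_indices (nidx N - 1)) (CSeq (copy_index A hr src)
      (CSeq (repeat_cmd K (CSeq (add_const A hr 3) (CCopy A hr t))) (set_const A pc 1)))))).

Lemma wp_setup src d x I Z :
  1 <= nidx N -> src <> pc -> src <> hr -> src <> t -> src <= off ->
  1 <= length x -> I src = 3 * length x + r -> nth (length x - 1) x d = d ->
  (forall i, 1 <= i <= length x -> Z (3 * i + r) = nth (i - 1) x d) ->
  wp (setup src) I Z (fun I' Z' =>
    simrel d (@init_conf A (length x) x d) I' Z' /\ frame I I' Z Z').
Proof.
  intros HN Hs1 Hs2 Hs3 Hs4 Hx Hsrc Hlast Hreg.
  apply wp_seq, wp_set_const, wp_seq, wp_copy, wp_seq, wp_copy_index; auto; try lia.
  { case_upd; lia. }
  apply wp_seq, wp_mono with (1 := wp_set_indices _ _ _); intros I1 Z1 (-> & E1 & E2).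
  assert (F1 : forall y, y <= off -> y <> t -> I1 y = I y)
    by (intros y Hy Hyt; rewrite E1 by lia; case_upd; auto).
  assert (F2 : I1 t = r) by (rewrite E1 by lia; case_upd; auto).
  assert (F3 : I1 (off + 1) = 3 * length x + r) by (rewrite E1 by lia; case_upd; auto).
  assert (F4 : forall y, off + nidx N < y -> I1 y = I y)
    by (intros y Hy; rewrite E1 by lia; case_upd; auto).
  apply wp_seq, wp_copy_index; auto; [rewrite F1; lia|].
  rewrite upd_same, (upd_other I r Hs3), (F1 src) by auto.
  rewrite Hsrc, Hreg, Hlast by lia.
  apply wp_seq.
  eapply wp_mono.
  - apply wp_repeat with (inv := fun k I' Z' =>
      I' = upd I1 hr (3 * (length x + k) + r) /\
      (forall a, (forall i, a <> 3 * i + r) -> Z' a = Z a) /\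
      Z' r = d /\ (forall i, 1 <= i <= length x + k -> Z' (3 * i + r) = nth (i - 1) x d)).
    + intros k I' Z' _ (-> & G1 & G2 & G3).
      apply wp_seq, wp_add_const, wp_copy.
      rewrite upd_same, upd_upd.
      replace (3 * (length x + k) + r + 3) with (3 * (length x + S k) + r) by lia.
      rewrite upd_same, (upd_other I1) by auto; rewrite F2, G2; repeat split.
      * intros a Ha; rewrite upd_other; auto.
      * case_upd; auto.
      * intros i Hi; destruct (Nat.eq_dec i (length x + S k)) as [->|]; case_upd.
        -- rewrite nth_overflow; [reflexivity | lia].
        -- apply G3; lia.
    + rewrite Nat.add_0_r; repeat split.
      * intros a Ha; case_upd; auto. exfalso; apply (Ha 0); reflexivity.
      * apply upd_same.
      * intros i Hi; case_upd; auto.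
  - intros I' Z' (-> & G1 & G2 & G3).
    apply wp_set_const; [lia | split].
    + exists (length x + K); simpl; repeat split; auto.
      * apply upd_same.
      * case_upd; lia.
      * lia.
      * destruct (Nat.eqb_spec j 1) as [->|]; case_upd; [exact F3|].
        rewrite E2; lia.
      * destruct (Nat.eqb_spec j 1); lia.
      * destruct (Nat.eqb_spec j 1); lia.
      * intros i Hi; rewrite nth_overflow; [reflexivity | lia].
    + split; [|exact G1].
      intros y ? ? ? [?|?]; case_upd; auto.
Qed.

Lemma block_ok k ins :
  off + nidx N <= k -> instr_ok true N ins -> (forall j, 1 <= j -> cmd_ok k (nu j)) ->
  cmd_ok k (block ins).
Proof.
  intros Hk Hi Hnu.
  destruct ins as [j i args | j i | j l | i args l1 l2 | j l l1 l2 | j | j | | j];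
    cbn [block cmd_ok]; simpl in Hi; unfold ireg_ok, label_ok in Hi;
    repeat split; try lia; try (apply set_const_ok || apply add_const_ok); try lia;
    try (rewrite length_map; tauto);
    try (apply Forall_map, Forall_forall; intros; lia).
  apply Hnu; lia.
Qed.

Lemma simstep_ok k :
  off + nidx N <= k -> (forall j, 1 <= j -> cmd_ok k (nu j)) -> cmd_ok k simstep.
Proof.
  intros Hk Hnu; unfold simstep; generalize 1.
  induction Hok as [|ins p Hi _ IH]; intros l; cbn [dispatch cmd_ok]; auto.
  split; [apply set_const_ok; lia|].
  split; [lia | split; [lia | split]].
  - now apply block_ok.
  - apply IH; [now inversion Hok | now inversion HK].
Qed.

Lemma setup_ok k src :
  off + nidx N <= k -> 1 <= nidx N -> 1 <= src <= off -> cmd_ok k (setup src).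
Proof.
  intros Hk HN Hs; cbn [setup cmd_ok].
  split; [apply set_const_ok; lia|].
  split; [lia|].
  split; [apply copy_index_ok; lia|].
  split; [|split; [apply copy_index_ok; lia | split; [|apply set_const_ok; lia]]].
  - assert (G : forall m, m <= nidx N - 1 -> cmd_ok k (set_indices m)); [|apply G; lia].
    induction m; cbn [set_indices cmd_ok]; intros; [exact I|].
    split; [apply IHm; lia | apply set_const_ok; lia].
  - apply repeat_cmd_ok; split; [apply add_const_ok; lia | simpl; lia].
Qed.

End Simulator.

(** * Bounded runs of deterministic machines *)

Section BoundedRuns.
Context (A : structure) (N : machine A) (Q : list (U A) -> Prop).

Lemma step_det c c1 c2 :
  (forall j, fetch N (lab c) <> Some (INu j)) -> step Q N c c1 -> step Q N c c2 -> c1 = c2.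
Proof.
  unfold step, fetch; intros Hnu [_ H1] [_ H2].
  destruct (nth_error (prog N) (lab c - 1)) as [[]|]; try contradiction; try congruence.
  - destruct H1 as [[? ->] | [? ->]], H2 as [[? ->] | [? ->]]; auto; contradiction.
  - now destruct (Hnu j).
Qed.

Inductive advances (c : config A) : nat -> config A -> Prop :=
| advances_0 : advances c 0 c
| advances_S n c1 c2 : advances c n c1 -> advance Q N c1 c2 -> advances c (S n) c2.

Context (HN : wf false N).

Lemma wf_no_nu l j : fetch N l <> Some (INu j).
Proof.
  intros H; destruct HN as (_ & _ & _ & Hok).
  apply nth_error_In in H; rewrite Forall_forall in Hok.
  destruct (Hok _ H); discriminate.
Qed.

Lemma wf_length_pos : 1 <= length (prog N).
Proof.
  destruct HN as (_ & [p ->] & _); rewrite length_app; simpl; lia.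
Qed.

Lemma stop_idle c : lab c = length (prog N) -> forall c1, ~ step Q N c c1.
Proof.
  intros Hl c1 [_ Hs]; rewrite Hl in Hs; destruct HN as (_ & [p Hp] & _).
  rewrite Hp, length_app, nth_error_app2 in Hs; simpl in Hs; [|simpl; lia].
  replace (length p + 1 - 1 - length p) with 0 in Hs by lia; exact Hs.
Qed.

Lemma advance_det c c1 c2 : advance Q N c c1 -> advance Q N c c2 -> c1 = c2.
Proof.
  intros [H1 | [H1 ->]] [H2 | [H2 ->]]; auto.
  - eapply step_det; eauto. intros j; apply wf_no_nu.
  - now apply H2 in H1.
  - now apply H1 in H2.
Qed.

Lemma advances_det c n c1 : advances c n c1 -> forall c2, advances c n c2 -> c1 = c2.
Proof.
  induction 1 as [|n c1 c2 _ IH Ha]; intros c3 H3; inversion H3; subst; auto.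
  match goal with H : advances c n ?c0 |- _ => rewrite (IH _ H) in Ha end.
  eapply advance_det; eassumption.
Qed.

Lemma advances_cons c c1 n c2 :
  advance Q N c c1 -> advances c1 n c2 -> advances c (S n) c2.
Proof.
  intros H; induction 1; econstructor; eauto using advances_0.
Qed.

Lemma advances_of_nsteps n c c' : nsteps Q N n c c' -> advances c n c'.
Proof.
  induction 1; [constructor|]. eapply advances_cons; [left|]; eassumption.
Qed.

Lemma nsteps_snoc n c c1 c2 :
  nsteps Q N n c c1 -> step Q N c1 c2 -> nsteps Q N (S n) c c2.
Proof.
  induction 1; intros; repeat (econstructor; eauto).
Qed.

(** Idle rounds pad a halting run of [k <= n] steps to exactly [n] rounds, and determinism
    identifies its end with [c']. *)
Lemma advances_halt n c c' : advances c n c' ->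
  (lab c' = length (prog N) <->
   exists k c1, k <= n /\ nsteps Q N k c c1 /\ lab c1 = length (prog N)).
Proof.
  intros Ha; split.
  - intros Hl.
    assert (H : exists k, k <= n /\ nsteps Q N k c c').
    { clear Hl; induction Ha as [|n c1 c2 _ (k & Hk & IH) [Hs | [_ ->]]].
      - exists 0; split; [lia | constructor].
      - exists (S k); split; [lia | eapply nsteps_snoc; eassumption].
      - exists k; split; [lia | assumption]. }
    destruct H as (k & Hk & H); eauto.
  - intros (k & c1 & Hk & Hn & Hl).
    apply advances_of_nsteps in Hn.
    assert (H : advances c n c1).
    { replace n with ((n - k) + k) by lia; induction (n - k); [exact Hn|].
      econstructor; [eassumption|]. right; split; [now apply stop_idle | reflexivity]. }
    rewrite (advances_det Ha H); exact Hl.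
Qed.

End BoundedRuns.

Lemma instr_ok_weaken (A : structure) (N : machine A) ins :
  instr_ok false N ins -> instr_ok true N ins.
Proof. destruct ins; simpl; auto. intros [? _]; discriminate. Qed.

Lemma last_default (X : Type) (l : list X) d d' : l <> [] -> last l d = last l d'.
Proof.
  induction l as [|a [|b l] IH]; simpl; intros H; [congruence | reflexivity|].
  apply IH; discriminate.
Qed.

Lemma nth_last (X : Type) (l : list X) d : nth (length l - 1) l d = last l d.
Proof.
  induction l as [|a [|b l] IH]; auto.
  simpl length in *; rewrite Nat.sub_succ, Nat.sub_0_r in *; exact IH.
Qed.

(** * Copying register ranges *)

Section CopyRange.
Context (A : structure).

Definition copy_range (a b src dst e : nat) : cmd A :=
  CWhileNe src e (CSeq (add_const A dst b) (CSeq (CCopy A dst src) (add_const A src a))).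

(* [dst] is advanced before each copy, so it ends on the last written register. *)
Lemma wp_copy_range a b src dst e n s0 d0 I Z :
  1 <= a -> 1 <= b -> src <> dst -> src <> e -> dst <> e ->
  I src = s0 -> I dst = d0 -> I e = s0 + a * n ->
  (forall i k, 1 <= i <= n -> k < n -> d0 + b * i <> s0 + a * k) ->
  wp (copy_range a b src dst e) I Z (fun I' Z' =>
    I' src = s0 + a * n /\ I' dst = d0 + b * n /\
    (forall x, x <> src -> x <> dst -> I' x = I x) /\
    (forall i, 1 <= i <= n -> Z' (d0 + b * i) = Z (s0 + a * (i - 1))) /\
    (forall x, (forall i, 1 <= i <= n -> x <> d0 + b * i) -> Z' x = Z x)).
Proof.
  intros Ha Hb Hsd Hse Hde Es Ed Ee Hdis.
  eapply wp_mono.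
  - apply wp_while_count with (N := n) (inv := fun k I' Z' => k <= n /\
      I' src = s0 + a * k /\ I' dst = d0 + b * k /\
      (forall x, x <> src -> x <> dst -> I' x = I x) /\
      (forall i, 1 <= i <= k -> Z' (d0 + b * i) = Z (s0 + a * (i - 1))) /\
      (forall x, (forall i, 1 <= i <= k -> x <> d0 + b * i) -> Z' x = Z x)).
    + intros k I' Z' (Hk & E1 & E2 & E3 & _); rewrite E1, E3, Ee by auto; nia.
    + intros k I' Z' Hkn (Hk & E1 & E2 & E3 & E4 & E5).
      apply wp_seq, wp_add_const, wp_seq, wp_copy, wp_add_const.
      rewrite !upd_same, !(upd_other I' _ Hsd), E1, E2.
      replace (d0 + b * k + b) with (d0 + b * S k) by nia.
      repeat split.
      * lia.
      * case_upd; lia.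
      * case_upd; lia.
      * intros; case_upd; auto.
      * intros i Hi; destruct (Nat.eq_dec i (S k)) as [->|].
        -- rewrite upd_same, E5; [replace (S k - 1) with k by lia; reflexivity|].
           intros i Hi' e0; apply (Hdis i k); lia.
        -- assert (b * i < b * S k) by (apply Nat.mul_lt_mono_pos_l; lia).
           rewrite upd_other by lia; apply E4; lia.
      * intros x Hx; rewrite upd_other by (apply Hx; lia).
        apply E5; intros; apply Hx; lia.
    + rewrite Es, Ed; repeat split; auto; intros; lia.
  - intros I' Z' (_ & H); exact H.
Qed.

Lemma copy_range_ok k a b src dst e :
  1 <= src <= k -> 1 <= dst <= k -> 1 <= e <= k -> cmd_ok k (copy_range a b src dst e).
Proof.
  intros; cbn [copy_range cmd_ok].
  split; [lia | split; [lia | split; [now apply add_const_ok | split; [lia | now apply add_const_ok]]]].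
Qed.

End CopyRange.

(** * Answering oracle queries by search *)

(* Index registers: [rN] holds the input length; [rPC], [rH], [rT] and [rQPC],
   [rQH], [rQT] belong to the simulations of the oracle machine and of the
   machine for [Q], whose stop labels are kept in [rL] and [rQL]; [rP] points to
   the first unused guess, [rM] and [rSE] to the guesses [m] and [s] places after
   it, [rS] holds [s + 1]; [rA], [rB], [rE], [rC] are scratch. *)
Local Notation rN := 1 (only parsing).
Local Notation rPC := 2 (only parsing).
Local Notation rH := 3 (only parsing).
Local Notation rT := 4 (only parsing).
Local Notation rP := 5 (only parsing).
Local Notation rL := 6 (only parsing).
Local Notation rA := 7 (only parsing).
Local Notation rB := 8 (only parsing).
Local Notation rE := 9 (only parsing).
Local Notation rM := 10 (only parsing).
Local Notation rS := 11 (only parsing).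
Local Notation rSE := 12 (only parsing).
Local Notation rQPC := 13 (only parsing).
Local Notation rQH := 14 (only parsing).
Local Notation rQT := 15 (only parsing).
Local Notation rQL := 16 (only parsing).
Local Notation rC := 17 (only parsing).
Local Notation offM := 20 (only parsing).

Section Query.
Context (A : structure) (M MQ : machine A) (KM KQ : nat).
Context (HM : wf true M) (HMQ : wf false MQ).
Context (HKQ : Forall (fixed_le KQ) (prog MQ)).

Local Notation offQ := (offM + nidx M) (only parsing).
Local Notation relM := (simrel M 1 rPC rH offM KM).
Local Notation relQ := (simrel MQ 2 rQPC rQH offQ KQ).

Definition accepts (x : list (U A)) (s : nat) : Prop :=
  exists x0 xs, x = x0 :: xs /\ exists k c, k <= s /\
    nsteps (@noQ A) MQ k (@init_conf A (length x) x (last x x0)) c /\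
    lab c = length (prog MQ).

Lemma accepts_HS x : HS_det MQ x <-> exists s, accepts x s.
Proof.
  split.
  - intros (x0 & xs & E & c & Hrun & Hl).
    apply nsteps_of_run in Hrun as [k Hk]; exists k, x0, xs; eauto 6.
  - intros (s & x0 & xs & E & k & c & _ & Hk & Hl).
    exists x0, xs; split; [exact E|]. exists c; split; [|exact Hl].
    eapply run_of_nsteps; exact Hk.
Qed.

Lemma accepts_mono x s s' : s <= s' -> accepts x s -> accepts x s'.
Proof.
  intros Hs (x0 & xs & E & k & c & Hk & H); exists x0, xs; split; [exact E|].
  exists k, c; split; [lia | exact H].
Qed.

Definition simstepQ : cmd A := simstep MQ 2 rQPC rQH rQT offQ (fun _ => CSkip A).

(** Counter and limit are both shifted by one, since index registers cannot hold 0. *)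
Definition run_bounded : cmd A :=
  CSeq (set_const A rC 1) (CWhileNe rC rS (CSeq simstepQ (CIncr A rC))).

(** Protected are the input length, the simulation of the oracle machine with its index registers,
    the guess pointer, the search registers [rM], [rS], [rSE] and the stop label [rQL]. *)
Definition qframe (I I' : nat -> nat) (Z Z' : nat -> U A) : Prop :=
  (forall x, x <= 6 \/ 10 <= x <= 12 \/ x = 16 \/ 20 < x <= 20 + nidx M -> I' x = I x) /\
  (forall a, (forall i, a <> 3 * i + 2) -> Z' a = Z a).

Lemma qframe_trans I I1 I2 Z Z1 Z2 :
  qframe I I1 Z Z1 -> qframe I1 I2 Z1 Z2 -> qframe I I2 Z Z2.
Proof.
  intros [H1 H2] [H3 H4]; split; intros; [rewrite H3, H1 | rewrite H4, H2]; auto.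
Qed.

Lemma qframe_of_frame I I' Z Z' :
  frame MQ 2 rQPC rQH rQT offQ I I' Z Z' -> qframe I I' Z Z'.
Proof. intros [H1 H2]; split; [|exact H2]. intros x Hx; apply H1; lia. Qed.

Lemma wp_run_bounded d c I Z s :
  relQ d c I Z -> I rS = s + 1 ->
  wp run_bounded I Z (fun I' Z' => qframe I I' Z Z' /\
    exists c', advances MQ (@noQ A) c s c' /\ I' rQPC = lab c').
Proof.
  intros HQ HS; apply wp_seq, wp_set_const; [lia|].
  eapply wp_mono.
  - apply wp_while_count with (N := s) (inv := fun k I' Z' =>
      I' rC = k + 1 /\ qframe I I' Z Z' /\
      exists c', advances MQ (@noQ A) c k c' /\ relQ d c' I' Z').
    + intros k I' Z' (E1 & [F _] & _); rewrite E1, F, HS by lia; lia.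
    + intros k I' Z' Hk (E1 & F & c' & Hadv & Hrel).
      apply wp_seq; eapply wp_mono.
      * unfold simstepQ; eapply simstep_plain with (Q := @noQ A) (c := c') (K := KQ); eauto; try lia.
        -- apply Forall_impl with (2 := proj2 (proj2 (proj2 HMQ))); apply instr_ok_weaken.
        -- intros j _; now apply wf_no_nu.
      * intros I1 Z1 (c1 & Ha & Hrel1 & HF); apply wp_incr.
        pose proof (qframe_of_frame HF) as F1; destruct HF as [HF _].
        split; [|split].
        -- rewrite upd_same, HF by lia; lia.
        -- eapply qframe_trans; [exact F|]. eapply qframe_trans; [exact F1|].
           split; auto. intros; case_upd; auto.
        -- exists c1; split; [econstructor; eassumption|].
           eapply simrel_ext; [exact Hrel1 | | | |]; intros; case_upd; auto.
    + split; [reflexivity | split].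
      * split; auto. intros; case_upd; auto.
      * exists c; split; [constructor|].
        eapply simrel_ext; [exact HQ | | | |]; intros; case_upd; auto.
  - intros I' Z' (_ & F & c' & Ha & h & Epc & _); eauto.
Qed.

Definition setupQ : cmd A := setup MQ 2 rQPC rQH rQT offQ KQ rB.

(** The window of the oracle machine starts at address 4 and ends at the content of index register
    21, its scaled $I_1$; adding 3 gives the exclusive end. [rB] starts at 2, one place before
    address 5 of the first register in its class. The guesses from [rP] up to [rM], exclusive, are
    appended, after which [rB] points to the last element, as [setupQ] expects. *)
Definition attempt : cmd A :=
  CSeq (set_const A rA 4) (CSeq (set_const A rB 2) (CSeq (copy_index A rE 21)
    (CSeq (add_const A rE 3) (CSeq (copy_range A 3 3 rA rB rE) (CSeq (copy_index A rA rP)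
      (CSeq (copy_range A 3 3 rA rB rM) (CSeq setupQ run_bounded))))))).

Definition qword (c : config A) (g : nat -> U A) (p m : nat) : list (U A) :=
  zwindow (zreg c) (ireg c 1) ++ map (fun k => g (p + k)) (seq 0 m).

Lemma qword_length c g p m : length (qword c g p m) = ireg c 1 + m.
Proof. unfold qword, zwindow; now rewrite length_app, !length_map, !length_seq. Qed.

Lemma qword_nth_window c g p m d i :
  1 <= i <= ireg c 1 -> nth (i - 1) (qword c g p m) d = zreg c i.
Proof.
  intros Hi; unfold qword, zwindow.
  rewrite app_nth1 by (rewrite length_map, length_seq; lia).
  rewrite nth_indep with (d' := zreg c 0) by (rewrite length_map, length_seq; lia).
  rewrite map_nth, seq_nth by lia; f_equal; lia.
Qed.

Lemma qword_nth_guess c g p m d k :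
  k < m -> nth (ireg c 1 + k) (qword c g p m) d = g (p + k).
Proof.
  intros Hi; unfold qword, zwindow.
  rewrite app_nth2; rewrite length_map, length_seq; [|lia].
  replace (ireg c 1 + k - ireg c 1) with k by lia.
  rewrite nth_indep with (d' := (fun k => g (p + k)) 0) by (rewrite length_map, length_seq; lia).
  rewrite (map_nth (fun k => g (p + k))), seq_nth by lia; f_equal; lia.
Qed.

Lemma wp_attempt d c I Z g p m s :
  relM d c I Z -> (forall k, Z (3 * k + 3) = g k) ->
  I rP = 3 * p + 3 -> I rM = 3 * (p + m) + 3 -> I rS = s + 1 -> 1 <= m ->
  wp attempt I Z (fun I' Z' => qframe I I' Z Z' /\
    (I' rQPC = length (prog MQ) <-> accepts (qword c g p m) s)).
Proof.
  intros (h & _ & _ & _ & Hidx & _ & Hz & _) Hg HP HMm HS Hm.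
  destruct HM as (HnM & _).
  destruct (Hidx 1) as [E21 B21]; [lia|]; simpl in E21.
  set (n := ireg c 1) in *.
  apply wp_seq, wp_set_const, wp_seq, wp_set_const, wp_seq, wp_copy_index; try lia.
  { case_upd; lia. }
  apply wp_seq, wp_add_const, wp_seq.
  eapply wp_mono.
  { apply wp_copy_range with (n := n) (s0 := 4) (d0 := 2); try lia; case_upd; lia. }
  intros I1 Z1 (_ & EB1 & FI1 & W1 & FZ1); cbv beta.
  assert (F1 : forall x, x <> 7 -> x <> 8 -> x <> 9 -> I1 x = I x)
    by (intros; rewrite FI1 by auto; case_upd; auto).
  apply wp_seq, wp_copy_index; [lia | rewrite F1; lia|].
  apply wp_seq; eapply wp_mono.
  { apply wp_copy_range with (n := m) (s0 := 3 * p + 3) (d0 := 2 + 3 * n); try lia;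
      case_upd; rewrite ?EB1, ?F1 by lia; lia. }
  intros I2 Z2 (_ & EB2 & FI2 & W2 & FZ2); cbv beta.
  assert (F2 : forall x, x <> 7 -> x <> 8 -> x <> 9 -> I2 x = I x)
    by (intros; rewrite FI2 by auto; case_upd; auto).
  assert (G2 : forall a, (forall i, a <> 3 * i + 2) -> Z2 a = Z a).
  { intros a Ha; rewrite FZ2, FZ1; auto; intros i _ ->.
    - apply (Ha i); lia.
    - apply (Ha (n + i)); lia. }
  set (x := qword c g p m).
  assert (Hlen : length x = n + m) by apply qword_length.
  assert (Hx : exists x0 xs, x = x0 :: xs).
  { destruct x as [|x0 xs]; [simpl in Hlen; lia | eauto]. }
  destruct Hx as (x0 & xs & Ex).
  assert (Hreg : forall i, 1 <= i <= length x -> Z2 (3 * i + 2) = nth (i - 1) x (last x x0)).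
  { intros i Hi; destruct (Nat.le_gt_cases i n) as [Hin | Hin].
    - rewrite FZ2 by (intros; lia).
      replace (3 * i + 2) with (2 + 3 * i) by lia; rewrite W1 by lia.
      unfold x; rewrite qword_nth_window by (fold n; lia).
      rewrite <- Hz by lia; f_equal; lia.
    - replace (3 * i + 2) with (2 + 3 * n + 3 * (i - n)) by lia; rewrite W2 by lia.
      replace (i - 1) with (n + (i - n - 1)) by lia; unfold x, n.
      rewrite qword_nth_guess by (fold n; lia); fold n.
      rewrite FZ1 by (intros; lia).
      rewrite <- Hg; f_equal; lia. }
  apply wp_seq; eapply wp_mono.
  { unfold setupQ; apply wp_setup with (x := x) (d := last x x0); try lia.
    - apply (proj1 HMQ).
    - rewrite nth_last; apply last_default; congruence.
    - exact Hreg. }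
  intros I3 Z3 (Hrel3 & HF3); apply qframe_of_frame in HF3.
  eapply wp_mono.
  { apply wp_run_bounded with (s := s) (1 := Hrel3).
    rewrite (proj1 HF3), F2 by lia; exact HS. }
  intros I4 Z4 (HF4 & c' & Hadv & Epc); split.
  - apply qframe_trans with (2 := HF4), qframe_trans with (2 := HF3).
    split; [intros; apply F2; lia | exact G2].
  - rewrite Epc, (advances_halt HMQ Hadv); unfold accepts; fold x; split.
    + intros (k & c1 & H); exists x0, xs; split; [exact Ex|]; eauto.
    + intros (y0 & ys & Ey & k & c1 & H).
      (* The head named in [accepts] only serves as the default of [last] on a nonempty list. *)
      rewrite (last_default (l := x) y0 x0) in H by congruence; eauto.
Qed.

(* All pairs of [m] guesses and [s] steps with [m <= s] are tried by increasing
   [s], so that the rounds up to [s] inspect only the first [s] guesses. *)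
Definition next_attempt : cmd A :=
  CIfEq rM rSE
    (CSeq (add_const A rSE 3) (CSeq (CIncr A rS) (CSeq (copy_index A rM rP) (add_const A rM 3))))
    (add_const A rM 3).

Definition search_loop : cmd A :=
  CWhileNe rQPC rQL (CSeq next_attempt attempt).

Definition search_state (d : U A) (c : config A) (g : nat -> U A) (p m s : nat)
  (I : nat -> nat) (Z : nat -> U A) : Prop :=
  relM d c I Z /\ (forall k, Z (3 * k + 3) = g k) /\ m <= s /\
  I rP = 3 * p + 3 /\ I rM = 3 * (p + m) + 3 /\ I rSE = 3 * (p + s) + 3 /\ I rS = s + 1 /\
  I rQL = length (prog MQ).

(** Compared with [qframe], the registers driven by the search itself lose their protection. *)
Definition sframe (I I' : nat -> nat) (Z Z' : nat -> U A) : Prop :=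
  (forall x, x <= 6 \/ 20 < x <= 20 + nidx M -> I' x = I x) /\
  (forall a, (forall i, a <> 3 * i + 2) -> Z' a = Z a).

Lemma sframe_trans I I1 I2 Z Z1 Z2 :
  sframe I I1 Z Z1 -> sframe I1 I2 Z1 Z2 -> sframe I I2 Z Z2.
Proof.
  intros [H1 H2] [H3 H4]; split; intros; [rewrite H3, H1 | rewrite H4, H2]; auto.
Qed.

Lemma relM_sframe d c I I' Z Z' : relM d c I Z -> sframe I I' Z Z' -> relM d c I' Z'.
Proof.
  intros H [F1 F2]; eapply simrel_ext; [exact H | | | |]; intros.
  1-3: apply F1; lia.
  apply F2; intros; lia.
Qed.

Lemma wp_search_body d c g p m s I Z :
  search_state d c g p m s I Z ->
  wp (CSeq next_attempt attempt) I Z (fun I' Z' => exists m' s',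
    ((m = s /\ m' = 1 /\ s' = S s) \/ (m < s /\ m' = S m /\ s' = s)) /\
    search_state d c g p m' s' I' Z' /\ sframe I I' Z Z' /\
    (I' rQPC = length (prog MQ) <-> accepts (qword c g p m') s')).
Proof.
  intros (Hrel & Hg & Hms & HP & HMm & HSE & HS & HQL).
  assert (Hnext : forall I1 m' s', 1 <= m' <= s' ->
    ((m = s /\ m' = 1 /\ s' = S s) \/ (m < s /\ m' = S m /\ s' = s)) ->
    sframe I I1 Z Z -> I1 rM = 3 * (p + m') + 3 -> I1 rSE = 3 * (p + s') + 3 ->
    I1 rS = s' + 1 -> I1 rQL = length (prog MQ) ->
    wp attempt I1 Z (fun I' Z' => exists m' s',
      ((m = s /\ m' = 1 /\ s' = S s) \/ (m < s /\ m' = S m /\ s' = s)) /\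
      search_state d c g p m' s' I' Z' /\ sframe I I' Z Z' /\
      (I' rQPC = length (prog MQ) <-> accepts (qword c g p m') s'))).
  { intros I1 m' s' Hm' Hnx HF E1 E2 E3 E4.
    assert (HP1 : I1 rP = 3 * p + 3) by (rewrite (proj1 HF) by lia; exact HP).
    assert (Hrel1 : relM d c I1 Z) by (eapply relM_sframe; eassumption).
    eapply wp_mono; [eapply wp_attempt; eauto; lia|].
    intros I' Z' ([F1 F2] & Hacc); exists m', s'; split; [exact Hnx|].
    assert (HF' : sframe I1 I' Z Z') by (split; auto; intros; apply F1; lia).
    split; [|split; [eapply sframe_trans; eassumption | exact Hacc]].
    repeat split.
    - eapply relM_sframe; eassumption.
    - intros; rewrite F2; auto; intros; lia.
    - lia.
    - rewrite F1; lia.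
    - rewrite F1; lia.
    - rewrite F1; lia.
    - rewrite F1; lia.
    - rewrite F1; lia. }
  apply wp_seq, wp_ifeq; intros He.
  - assert (m = s) by lia; subst s.
    apply wp_seq, wp_add_const, wp_seq, wp_incr, wp_seq, wp_copy_index, wp_add_const; [lia| |].
    { case_upd; lia. }
    apply Hnext with (m' := 1) (s' := S m); try lia; try (case_upd; lia).
    split; auto; intros; case_upd; auto.
  - apply wp_add_const.
    apply Hnext with (m' := S m) (s' := s); try lia; try (case_upd; lia).
    split; auto; intros; case_upd; auto.
Qed.

(** As the loop is entered with [rQPC] off the stop label, only an accepting attempt can end it; the
    implication in the invariant holds vacuously at the start. *)
Lemma exec_search_loop d c g p I Z I' Z' m s :
  search_state d c g p m s I Z -> I rQPC <> length (prog MQ) ->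
  exec search_loop I Z I' Z' ->
  exists m' s', 1 <= m' <= s' /\ accepts (qword c g p m') s' /\
    search_state d c g p m' s' I' Z' /\ sframe I I' Z Z'.
Proof.
  intros H0 Hne He; unfold search_loop in He.
  apply exec_while_inv with (inv := fun I1 Z1 => exists m' s',
    search_state d c g p m' s' I1 Z1 /\ sframe I I1 Z Z1 /\
    (I1 rQPC = length (prog MQ) -> 1 <= m' /\ accepts (qword c g p m') s')) in He.
  - destruct He as [(m' & s' & Hst & HF & Hacc) E].
    pose proof Hst as (_ & _ & Hms & _ & _ & _ & _ & HQL).
    rewrite HQL in E; destruct (Hacc E).
    exists m', s'; auto.
  - intros I1 Z1 I2 Z2 _ (m1 & s1 & Hst & HF & _) He'.
    eapply wp_exec in He'; [|eapply wp_search_body; exact Hst].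
    destruct He' as (m' & s' & Hnx & Hst' & HF' & Hacc).
    exists m', s'; split; [exact Hst' | split; [eapply sframe_trans; eassumption|]].
    intros E; split; [lia | now apply Hacc].
  - exists m, s; split; [exact H0 | split; [now split | contradiction]].
Qed.

(** The pair [(s0, m0)] stays ahead of [(s, m)] lexicographically until the search stops, at the
    latest on that pair. The measure counts down this order: the weight [s0 + 1] of a round exceeds
    every value of [s0 - m]. *)
Lemma wp_search_loop d c g p m0 s0 : 1 <= m0 <= s0 -> accepts (qword c g p m0) s0 ->
  forall n I Z m s, n = (s0 - s) * (s0 + 1) + (s0 - m) ->
  s < s0 \/ (s = s0 /\ m < m0) ->
  search_state d c g p m s I Z -> I rQPC <> length (prog MQ) ->
  wp search_loop I Z (fun I' Z' => exists m' s', s' <= s0 /\ search_state d c g p m' s' I' Z').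
Proof.
  intros H0 Hacc0 n; induction n as [n IH] using lt_wf_ind; intros I Z m s En Hlt Hst Hne.
  apply wp_while_next.
  - destruct Hst as (_ & _ & _ & _ & _ & _ & _ & HQL); rewrite HQL; exact Hne.
  - eapply wp_mono; [eapply wp_search_body; exact Hst|].
    intros I' Z' (m' & s' & Hnx & Hst' & _ & Hacc).
    assert (Hms : m <= s) by apply Hst.
    destruct (Nat.eq_dec (I' rQPC) (length (prog MQ))) as [e | e].
    + apply wp_while_stop.
      * destruct Hst' as (_ & _ & _ & _ & _ & _ & _ & HQL); rewrite HQL; exact e.
      * exists m', s'; split; [lia | exact Hst'].
    + assert (~ (m' = m0 /\ s' = s0)) by (intros [-> ->]; tauto).
      refine (IH _ _ I' Z' m' s' eq_refl _ Hst' e); [|lia].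
      subst n; destruct Hnx as [(? & ? & ?) | (? & ? & ?)]; subst m' s'.
      * replace (s0 - s) with (S (s0 - S s)) by lia; lia.
      * lia.
Qed.

(** After an earlier query [rQPC] still holds the stop label; the value one above it is no stop
    label and forces a first attempt. *)
Definition query_start : cmd A :=
  CSeq (copy_index A rM rP) (CSeq (copy_index A rSE rP) (CSeq (set_const A rS 1)
    (CSeq (set_const A rQL (length (prog MQ))) (set_const A rQPC (S (length (prog MQ))))))).

Definition query_end (j : nat) : cmd A :=
  CSeq (set_const A rA (3 * j + 1)) (CSeq (CCopy A rA rP) (copy_index A rP rSE)).

Definition query (j : nat) : cmd A :=
  CSeq query_start (CSeq search_loop (query_end j)).

Lemma wp_query_start d c g p I Z :
  relM d c I Z -> (forall k, Z (3 * k + 3) = g k) -> I rP = 3 * p + 3 ->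
  wp query_start I Z (fun I' Z' => search_state d c g p 0 0 I' Z' /\
    sframe I I' Z Z' /\ I' rQPC <> length (prog MQ)).
Proof.
  intros Hrel Hg HP; pose proof (wf_length_pos HMQ) as HL.
  apply wp_seq, wp_copy_index, wp_seq, wp_copy_index, wp_seq, wp_set_const, wp_seq,
    wp_set_const, wp_set_const; try lia.
  { case_upd; lia. }
  match goal with |- search_state _ _ _ _ _ _ ?I1 _ /\ _ =>
    assert (HF : sframe I I1 Z Z) by (split; auto; intros; case_upd; auto) end.
  split; [|split; [exact HF | case_upd; lia]].
  split; [eapply relM_sframe; eassumption|].
  repeat split; auto; case_upd; lia.
Qed.

(** The label is still that of the query; the interpreter increments it afterwards. *)
Definition query_post (d : U A) (c : config A) (g : nat -> U A) (p s j : nat)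
  (I I' : nat -> nat) (Z' : nat -> U A) : Prop :=
  relM d (@mkConfig A (lab c) (ireg c) (upd (zreg c) j (g p))) I' Z' /\
  (forall k, Z' (3 * k + 3) = g k) /\ I' rP = 3 * (p + s) + 3 /\ I' rL = I rL.

Lemma wp_query_end d c g p m s j I I1 Z Z1 :
  1 <= j <= KM -> search_state d c g p m s I1 Z1 -> sframe I I1 Z Z1 ->
  wp (query_end j) I1 Z1 (fun I' Z' => query_post d c g p s j I I' Z').
Proof.
  intros Hj (Hrel & Hg & _ & HP & _ & HSE & _ & _) [HF _].
  apply wp_seq, wp_set_const, wp_seq, wp_copy, wp_copy_index; try lia.
  { case_upd; lia. }
  rewrite upd_same, !(upd_other I1) by lia; rewrite HP, Hg.
  split; [|split; [|split]].
  - eapply simrel_write with (1 := Hrel); try lia.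
    + eapply simrel_hr; [exact Hrel | lia].
    + destruct Hrel as (h & E & _); case_upd; exact E.
    + case_upd; auto.
    + intros; case_upd; auto.
    + intros; reflexivity.
  - intros k; case_upd; auto.
  - case_upd; lia.
  - case_upd; apply HF; lia.
Qed.

Lemma exec_query d c g p j I Z I' Z' :
  1 <= j <= KM -> relM d c I Z -> (forall k, Z (3 * k + 3) = g k) -> I rP = 3 * p + 3 ->
  exec (query j) I Z I' Z' ->
  exists m s, 1 <= m <= s /\ accepts (qword c g p m) s /\ query_post d c g p s j I I' Z'.
Proof.
  intros Hj Hrel Hg HP He; inversion He as [| | | | | |? ? ? ? I1 Z1 ? ? He1 He2| | | | | |]; subst.
  inversion He2 as [| | | | | |? ? ? ? I2 Z2 ? ? He3 He4| | | | | |]; subst.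
  eapply wp_exec in He1; [|eapply wp_query_start; eassumption].
  destruct He1 as (Hst & HF & Hne).
  eapply exec_search_loop in He3; [|exact Hst | exact Hne].
  destruct He3 as (m & s & Hms & Hacc & Hst' & HF').
  eapply wp_exec in He4; [|eapply wp_query_end; [exact Hj | exact Hst' | exact (sframe_trans HF HF')]].
  exists m, s; auto.
Qed.

Lemma wp_query d c g p j I Z m0 s0 :
  1 <= j <= KM -> relM d c I Z -> (forall k, Z (3 * k + 3) = g k) -> I rP = 3 * p + 3 ->
  1 <= m0 <= s0 -> accepts (qword c g p m0) s0 ->
  wp (query j) I Z (fun I' Z' => exists m s, 1 <= m <= s /\ s <= s0 /\
    accepts (qword c g p m) s /\ query_post d c g p s j I I' Z').
Proof.
  intros Hj Hrel Hg HP H0 Hacc0.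
  apply wp_seq; eapply wp_mono; [eapply wp_query_start; eassumption|].
  intros I1 Z1 (Hst & HF & Hne); apply wp_seq.
  destruct (wp_search_loop H0 Hacc0 (m := 0) (s := 0) eq_refl ltac:(lia) Hst Hne)
    as (I2 & Z2 & He & m' & s' & Hle & Hst').
  exists I2, Z2; split; [exact He|].
  destruct (exec_search_loop Hst Hne He) as (m & s & Hms & Hacc & Hst2 & HF2).
  (* The final content of [rSE] determines the round, so the bound from [wp_search_loop] and the
     acceptance from [exec_search_loop] concern the same round. *)
  assert (s = s').
  { destruct Hst' as (_ & _ & _ & _ & _ & E1 & _), Hst2 as (_ & _ & _ & _ & _ & E2 & _); lia. }
  subst s'.
  eapply wp_mono; [eapply wp_query_end; [exact Hj | exact Hst2 | exact (sframe_trans HF HF2)]|].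
  intros I' Z' Hpost; exists m, s; auto.
Qed.

Lemma query_ok k j : 20 + nidx M + nidx MQ <= k -> cmd_ok k (query j).
Proof.
  intros Hk; destruct HM as (HnM & _), HMQ as (HnQ & _ & _ & Hok).
  assert (Hsq : cmd_ok k simstepQ).
  { unfold simstepQ; eapply simstep_ok with (K := KQ); eauto; try lia.
    - apply Forall_impl with (2 := Hok); apply instr_ok_weaken.
    - intros; exact I. }
  assert (Hsu : cmd_ok k setupQ) by (apply setup_ok; lia).
  cbn [query query_start query_end search_loop next_attempt attempt run_bounded cmd_ok].
  repeat match goal with
  | |- _ /\ _ => split
  | |- cmd_ok _ (set_const _ _ _) => apply set_const_ok
  | |- cmd_ok _ (add_const _ _ _) => apply add_const_ok
  | |- cmd_ok _ (copy_index _ _ _) => apply copy_index_ok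
  | |- cmd_ok _ (copy_range _ _ _ _ _ _) => apply copy_range_ok
  end; auto; lia.
Qed.

End Query.

(** * The nondeterministic machine *)

Section Main.
Context (A : structure) (Q : list (U A) -> Prop) (M MQ : machine A) (KM KQ : nat).
Context (HM : wf true M) (HMQ : wf false MQ) (HQ : forall x, Q x <-> HS_det MQ x).
Context (HKM : Forall (fixed_le KM) (prog M)) (HKQ : Forall (fixed_le KQ) (prog MQ)).

Local Notation relM := (simrel M 1 rPC rH offM KM).

Definition simstepM : cmd A := simstep M 1 rPC rH rT offM (query M MQ KQ).

Definition main_loop : cmd A := CWhileNe rPC rL simstepM.

Definition main_state (d : U A) (g : nat -> U A) (p : nat) (c : config A)
  (I : nat -> nat) (Z : nat -> U A) : Prop :=
  relM d c I Z /\ (forall k, Z (3 * k + 3) = g k) /\ I rP = 3 * p + 3 /\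
  I rL = length (prog M).

Lemma simstepM_plain d g p c I Z :
  main_state d g p c I Z -> (forall j, 1 <= lab c -> fetch M (lab c) <> Some (INu j)) ->
  wp simstepM I Z (fun I' Z' => exists c', advance Q M c c' /\ main_state d g p c' I' Z').
Proof.
  intros (Hrel & Hg & HP & HL) Hnu.
  eapply wp_mono.
  - unfold simstepM; eapply simstep_plain with (Q := Q) (c := c) (K := KM); eauto; try lia.
    apply HM.
  - intros I' Z' (c' & Ha & Hrel' & F1 & F2); exists c'; split; [exact Ha|].
    split; [exact Hrel' | split; [|split]].
    + intros k; rewrite F2; auto; intros; lia.
    + rewrite F1; lia.
    + rewrite F1; lia.
Qed.

Lemma simstepM_nu d g p c I Z j I' Z' :
  main_state d g p c I Z -> 1 <= lab c -> fetch M (lab c) = Some (INu j) ->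
  1 <= j <= KM /\ main_state d g p c (upd I rT (lab c)) Z /\
  (exec simstepM I Z I' Z' <->
   exec (CSeq (query M MQ KQ j) (CIncr A rPC)) (upd I rT (lab c)) Z I' Z').
Proof.
  intros (Hrel & Hg & HP & HL) Hl Hf; split; [|split].
  - assert (Hin : In (INu j) (prog M)) by (eapply nth_error_In; exact Hf).
    split.
    + destruct HM as (_ & _ & _ & Hok); rewrite Forall_forall in Hok.
      now destruct (Hok _ Hin).
    + rewrite Forall_forall in HKM; exact (HKM _ Hin).
  - split; [|repeat split; auto; case_upd; auto].
    eapply simrel_ext; [exact Hrel | | | |]; intros; case_upd; auto.
  - unfold simstepM; eapply simstep_nu with (c := c) (K := KM); eauto; lia.
Qed.

Lemma query_post_incr d g p c s j I I1 Z1 :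
  I rL = length (prog M) -> query_post M KM d c g p s j I I1 Z1 ->
  main_state d g (p + s) (@mkConfig A (S (lab c)) (ireg c) (upd (zreg c) j (g p)))
    (upd I1 rPC (S (I1 rPC))) Z1.
Proof.
  intros HL (Hrel & Hg & HP & HL1).
  split; [|split; [exact Hg | split; case_upd; congruence]].
  pose proof Hrel as (h & E & _); simpl in E; rewrite E.
  eapply simrel_goto with (1 := Hrel); intros; case_upd; auto.
Qed.

Lemma exec_main_loop d g p c I Z I' Z' :
  main_state d g p c I Z -> exec main_loop I Z I' Z' -> halts Q M c.
Proof.
  intros H0 He; unfold main_loop in He.
  apply exec_while_inv with (inv := fun I1 Z1 => exists p1 c1,
    clos_refl_trans _ (step Q M) c c1 /\ main_state d g p1 c1 I1 Z1) in He.
  - destruct He as [(p1 & c1 & Hrun & (h & E & _) & _ & _ & HL) Ee].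
    exists c1; split; [exact Hrun | congruence].
  - clear H0 He I Z I' Z'; intros I Z I' Z' _ (p1 & c1 & Hrun & Hst) He.
    destruct (classic (exists j, 1 <= lab c1 /\ fetch M (lab c1) = Some (INu j)))
      as [(j & Hl & Hf) | Hno].
    + destruct (simstepM_nu I' Z' Hst Hl Hf) as (Hj & (Hrel & Hg & HP & HL) & Heq).
      apply Heq in He; inversion He as [| | | | | |? ? ? ? I1 Z1 ? ? He1 He2| | | | | |]; subst.
      apply exec_query with (d := d) (c := c1) (g := g) (p := p1) (KM := KM) in He1; auto.
      destruct He1 as (m & s & Hms & Hacc & Hpost).
      inversion He2; subst.
      exists (p1 + s); eexists; split; [|eapply query_post_incr; eauto].
      eapply rt_trans; [exact Hrun|]; apply rt_step.
      (* The accepted word is the window followed by [g p1] and [m - 1] further guesses, which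
         witness membership in [nu_set]. *)
      assert (HQm : Q (qword c1 g p1 m)) by (apply HQ, accepts_HS; eauto).
      destruct c1 as [l ci cz]; rewrite (step_fetch _ _ _ _ _ Hl Hf).
      left; exists (g p1); split; [|reflexivity].
      unfold qword in HQm; destruct m as [|m]; [lia|]; simpl in HQm.
      rewrite Nat.add_0_r in HQm; eexists; exact HQm.
    + eapply wp_exec in He; [|eapply simstepM_plain; [exact Hst | eauto]].
      destruct He as (c2 & Ha & Hst2); exists p1, c2; split; [|exact Hst2].
      destruct Ha as [Hs | [_ ->]]; [|exact Hrun].
      eapply rt_trans; [exact Hrun | apply rt_step; exact Hs].
  - exists p, c; split; [apply rt_refl | exact H0].
Qed.

(* A shortest stretch of guesses that answers the query: since the search in
   rounds [< s] cannot succeed, it consumes exactly [s] guesses. *)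
Lemma shortest_answer z y : nu_set Q z y ->
  exists s (g : nat -> U A) m, g 0 = y /\ 1 <= m <= s /\
    accepts MQ (z ++ map g (seq 0 m)) s /\
    forall s' (g' : nat -> U A) m', g' 0 = y -> 1 <= m' <= s' ->
      accepts MQ (z ++ map g' (seq 0 m')) s' -> s <= s'.
Proof.
  intros [ys Hys].
  set (P := fun s => exists (g : nat -> U A) m, g 0 = y /\ 1 <= m <= s /\
    accepts MQ (z ++ map g (seq 0 m)) s).
  assert (HP : exists s, P s).
  { apply HQ, accepts_HS in Hys as [s Hs].
    (* The round must bound both the steps and the number of guesses, hence the sum. *)
    exists (s + S (length ys)), (fun k => nth k (y :: ys) y), (S (length ys)).
    repeat split; try lia.
    apply accepts_mono with s; [lia|].
    replace (map _ _) with (y :: ys); [exact Hs|].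
    apply nth_ext with y y; [now rewrite length_map, length_seq|].
    intros k Hk; set (f := fun k => nth k (y :: ys) y).
    rewrite nth_indep with (l := map f _) (d' := f 0)
      by (rewrite length_map, length_seq; exact Hk).
    now rewrite map_nth, seq_nth. }
  destruct HP as [s Hs].
  revert Hs; induction s as [s IH] using lt_wf_ind; intros Hs.
  destruct (classic (exists s', s' < s /\ P s')) as [(s' & Hlt & Hs') | Hmin].
  - eapply IH; eassumption.
  - destruct Hs as (g & m & Hg & Hm & Hacc); exists s, g, m; repeat split; try tauto.
    intros s' g' m' H1 H2 H3; apply Nat.nlt_ge; intros Hlt.
    apply Hmin; exists s'; split; [exact Hlt|]; exists g', m'; auto.
Qed.

Lemma qword_ext (c : config A) g p g' m :
  (forall k, k < m -> g (p + k) = g' k) ->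
  qword c g p m = zwindow (zreg c) (ireg c 1) ++ map g' (seq 0 m).
Proof.
  intros H; unfold qword; f_equal; apply map_ext_in; intros k Hk.
  apply in_seq in Hk; apply H; lia.
Qed.

(** The guesses are built backwards along the run, those for the first query being put in front of
    those for the rest. Quantifying over [g], [p], [I], [Z] lets the rest start at any guess and
    with whatever memory the search leaves behind. *)
Lemma main_loop_terminates d n c cf :
  nsteps Q M n c cf -> lab cf = length (prog M) ->
  exists w, forall g p I Z, main_state d g p c I Z ->
    (forall k, k < length w -> g (p + k) = nth k w d) ->
    exists I' Z', exec main_loop I Z I' Z'.
Proof.
  intros Hn Hlab; induction Hn as [c | n c c1 c2 Hs Hn IH].
  - exists []; intros g p I Z ((h & E & _) & _ & _ & HL) _.
    exists I, Z; apply exec_while_stop; congruence.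
  - destruct (IH Hlab) as [w Hw]; clear IH.
    assert (Hstop : forall g p I Z, main_state d g p c I Z -> I rPC = I rL ->
      exists I' Z', exec main_loop I Z I' Z')
      by (intros; exists I, Z; now apply exec_while_stop).
    destruct (classic (exists j, fetch M (lab c) = Some (INu j))) as [(j & Hf) | Hno].
    + pose proof Hs as [Hl _].
      assert (Hs' : (exists y, nu_set Q (zwindow (zreg c) (ireg c 1)) y /\
          c1 = @mkConfig A (S (lab c)) (ireg c) (upd (zreg c) j y)) \/ c1 = c).
      { destruct c as [l ci cz]; rewrite (step_fetch _ _ _ _ _ Hl Hf) in Hs.
        destruct Hs as [Hs | [_ Hs]]; auto. }
      (* After an unanswerable query the configuration is unchanged, so the word for the remaining
         run serves as it is. *)
      destruct Hs' as [(y & Hy & ->) | ->]; [|exists w; exact Hw].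
      destruct (shortest_answer Hy) as (s & g0 & m & Hg0 & Hms & Hacc & Hmin).
      (* All [s] guesses are laid down, although the answer needs only [m], because the query
         consumes [s]. *)
      exists (map g0 (seq 0 s) ++ w).
      intros g p I Z Hst Hgw.
      rewrite length_app, length_map, length_seq in Hgw.
      assert (Hg1 : forall k, k < s -> g (p + k) = g0 k).
      { intros k Hk; rewrite Hgw by lia.
        rewrite app_nth1 by (rewrite length_map, length_seq; lia).
        rewrite nth_indep with (d' := g0 0) by (rewrite length_map, length_seq; lia).
        now rewrite map_nth, seq_nth. }
      assert (Hg2 : forall k, k < length w -> g (p + s + k) = nth k w d).
      { intros k Hk; rewrite <- Nat.add_assoc, Hgw by lia.
        rewrite app_nth2; rewrite length_map, length_seq; [|lia].
        f_equal; lia. }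
      assert (Hgp : g p = y) by (rewrite <- (Nat.add_0_r p), Hg1 by lia; exact Hg0).
      destruct (Nat.eq_dec (I rPC) (I rL)) as [e | e]; [eauto|].
      destruct (simstepM_nu I Z Hst Hl Hf) as (Hj & (Hrel & Hg & HP & HL) & _).
      destruct (@wp_query A M MQ KM KQ) with (d := d) (c := c) (g := g) (p := p) (j := j)
        (I := upd I rT (lab c)) (Z := Z) (m0 := m) (s0 := s)
        as (I1 & Z1 & He & m1 & s1 & Hms1 & Hle & Hacc1 & Hpost); auto.
      { rewrite qword_ext with (g' := g0); [exact Hacc|]. intros; apply Hg1; lia. }
      (* The search may have accepted some [m1] other than [m], but this too is an answer with first
         guess [y], so minimality yields [s <= s1]. *)
      rewrite qword_ext with (g' := fun k => g (p + k)) in Hacc1 by auto.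
      apply Hmin in Hacc1; [|now rewrite Nat.add_0_r | exact Hms1].
      assert (s1 = s) by lia; subst s1.
      apply query_post_incr in Hpost; [|exact HL]; rewrite Hgp in Hpost.
      destruct (Hw _ _ _ _ Hpost Hg2) as (I2 & Z2 & He2).
      exists I2, Z2; eapply exec_while_next; [exact e | | exact He2].
      apply (simstepM_nu _ _ Hst Hl Hf).
      econstructor; [exact He | constructor].
    + exists w; intros g p I Z Hst Hgw.
      destruct (Nat.eq_dec (I rPC) (I rL)) as [e | e]; [eauto|].
      destruct (simstepM_plain Hst) as (I1 & Z1 & He & c' & Ha & Hst1); [eauto|].
      assert (c' = c1) as ->.
      { destruct Ha as [Ha | [Ha _]]; [|now apply Ha in Hs].
        eapply step_det; eauto. }
      destruct (Hw _ _ _ _ Hst1 Hgw) as (I2 & Z2 & He2).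
      exists I2, Z2; eapply exec_while_next; eassumption.
Qed.

(* The input [x_1, ..., x_n] is first copied past register [3 * n + 1] and then
   spread over the registers [3 * i + 1]; the guesses used later are those in the
   registers [3 * k + 3] with [k >= 2 * n], which are not overwritten. *)
Definition init : cmd A :=
  CSeq (set_const A rC 1) (CSeq (set_const A rB 4) (CSeq (set_const A rP 9)
  (CSeq (CWhileNe rC rN (CSeq (CIncr A rC) (CSeq (add_const A rB 3) (add_const A rP 6))))
  (CSeq (set_const A rA 1) (CSeq (copy_index A rE rN) (CSeq (CIncr A rE)
  (CSeq (copy_index A rM rB) (CSeq (copy_range A 1 1 rA rB rE)
  (CSeq (copy_index A rA rM) (CSeq (CIncr A rA) (CSeq (copy_index A rE rB)
  (CSeq (CIncr A rE) (CSeq (set_const A rB 1) (CSeq (copy_range A 1 3 rA rB rE)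
  (CSeq (setup M 1 rPC rH rT offM KM rB) (set_const A rL (length (prog M)))))))))))))))))).

Lemma wf_true_length_pos : 1 <= length (prog M).
Proof.
  destruct HM as (_ & [p ->] & _); rewrite length_app; simpl; lia.
Qed.

Lemma wp_init x d I Z :
  1 <= length x -> I rN = length x -> last x d = d ->
  (forall i, 1 <= i <= length x -> Z i = nth (i - 1) x d) ->
  wp init I Z (fun I' Z' => relM d (@init_conf A (length x) x d) I' Z' /\
    I' rP = 3 * (2 * length x) + 3 /\ I' rL = length (prog M) /\
    forall k, 2 * length x <= k -> Z' (3 * k + 3) = Z (3 * k + 3)).
Proof.
  intros Hx HN Hlast Hz; set (n := length x) in *.
  apply wp_seq, wp_set_const, wp_seq, wp_set_const, wp_seq, wp_set_const, wp_seq; try lia.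
  eapply wp_mono.
  (* The start values 1, 4, 9 make [rB] equal to [3 * rC + 1] and [rP] equal to [6 * rC + 3]
     throughout; the loop ends with [rC] at [n]. *)
  { apply wp_while_count with (N := n - 1) (inv := fun k I' Z' => k <= n - 1 /\
      I' rC = k + 1 /\ I' rB = 3 * k + 4 /\ I' rP = 6 * k + 9 /\ I' rN = n /\ Z' = Z).
    - intros k I' Z' (Hk & E1 & _ & _ & E2 & _); lia.
    - intros k I' Z' Hk (_ & E1 & E2 & E3 & E4 & ->).
      apply wp_seq, wp_incr, wp_seq, wp_add_const, wp_add_const.
      repeat split; case_upd; lia.
    - repeat split; case_upd; lia. }
  intros I1 Z1 (_ & _ & EB & EP & EN & ->).
  apply wp_seq, wp_set_const, wp_seq, wp_copy_index, wp_seq, wp_incr, wp_seq, wp_copy_index,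
    wp_seq; try lia; try (case_upd; lia).
  eapply wp_mono.
  (* The copy occupies registers [3 * n + 2] to [4 * n + 1], beyond the last target [3 * n + 1] of
     the spreading and below the first guess used, at [6 * n + 3]. *)
  { apply wp_copy_range with (n := n) (s0 := 1) (d0 := 3 * n + 1); try lia; case_upd; lia. }
  intros I2 Z2 (_ & EB2 & FI2 & W2 & FZ2); cbv beta.
  assert (EM2 : I2 rM = 3 * n + 1) by (rewrite FI2 by lia; case_upd; lia).
  assert (EP2 : I2 rP = 6 * n + 3) by (rewrite FI2 by lia; case_upd; lia).
  apply wp_seq, wp_copy_index, wp_seq, wp_incr, wp_seq, wp_copy_index, wp_seq, wp_incr,
    wp_seq, wp_set_const, wp_seq; try lia; try (case_upd; lia).
  eapply wp_mono.
  { apply wp_copy_range with (n := n) (s0 := 3 * n + 2) (d0 := 1); try lia; case_upd; lia. }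
  intros I3 Z3 (_ & EB3 & FI3 & W3 & FZ3); cbv beta.
  assert (EP3 : I3 rP = 6 * n + 3) by (rewrite FI3 by lia; case_upd; lia).
  apply wp_seq; eapply wp_mono.
  { apply wp_setup with (x := x) (d := d); fold n; try lia.
    - apply HM.
    - unfold n; now rewrite nth_last.
    - intros i Hi; replace (3 * i + 1) with (1 + 3 * i) by lia; rewrite W3 by lia.
      replace (3 * n + 2 + 1 * (i - 1)) with (3 * n + 1 + 1 * i) by lia.
      rewrite W2 by lia; rewrite <- Hz by lia; f_equal; lia. }
  intros I4 Z4 (Hrel & F4 & G4).
  apply wp_set_const; [apply wf_true_length_pos|].
  split; [|split; [|split]].
  - eapply simrel_ext; [exact Hrel | | | |]; intros; case_upd; auto.
  - case_upd; rewrite F4; lia.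
  - apply upd_same.
  - intros k Hk; rewrite G4 by (intros; lia).
    rewrite FZ3, FZ2; auto; intros; lia.
Qed.

Definition nd_machine : machine A :=
  machine_of (20 + nidx M + nidx MQ) (CSeq init main_loop).

Lemma nd_machine_wf : wf false nd_machine.
Proof.
  apply machine_of_wf; [lia|].
  pose proof HM as (HnM & _ & _ & HokM).
  assert (Hsu : cmd_ok (20 + nidx M + nidx MQ) (setup M 1 rPC rH rT offM KM rB))
    by (apply setup_ok; lia).
  assert (Hst : cmd_ok (20 + nidx M + nidx MQ) simstepM).
  { unfold simstepM; eapply simstep_ok with (K := KM); eauto; try lia.
    intros j _; apply query_ok; auto. }
  cbn [init main_loop cmd_ok].
  repeat match goal with
  | |- _ /\ _ => split
  | |- cmd_ok _ (set_const _ _ _) => apply set_const_ok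
  | |- cmd_ok _ (add_const _ _ _) => apply add_const_ok
  | |- cmd_ok _ (copy_index _ _ _) => apply copy_index_ok
  | |- cmd_ok _ (copy_range _ _ _ _ _ _) => apply copy_range_ok
  end; auto; lia.
Qed.

Lemma nd_machine_correct x : HS_nu Q M x <-> HS_nd nd_machine x.
Proof.
  split; intros (x0 & xs & Ex & H); exists x0, xs; split; auto;
    set (d := last x x0) in *;
    (assert (Hd : last x d = d) by (apply last_default; congruence));
    (assert (Hx : 1 <= length x) by (rewrite Ex; simpl; lia)).
  - destruct H as (cf & Hrun & Hl); apply nsteps_of_run in Hrun as [k Hk].
    destruct (main_loop_terminates d Hk Hl) as [w Hw].
    set (n := length x) in *.
    (* Register [6 * n + 3 + 3 * k] must hold entry [k] of [w]; the values of [f] at other registers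
       are arbitrary fillers. *)
    set (f := fun i => nth ((i - (6 * n + 3)) / 3) w d).
    set (ys := map f (seq (n + 1) (6 * n + 3 + 3 * length w))).
    assert (Ey : exists y0 ys', ys = y0 :: ys').
    { destruct ys as [|y0 ys'] eqn:E; [|eauto].
      apply (f_equal (@length _)) in E; unfold ys in E; rewrite length_map, length_seq in E.
      simpl in E; lia. }
    destruct Ey as (y0 & ys' & Ey); exists y0, ys'; rewrite <- Ey.
    apply machine_of_halts.
    destruct (@wp_init x d (fun j => if Nat.eqb j 1 then n else 1) (fun i => nth (i - 1) (x ++ ys) d))
      as (I1 & Z1 & He1 & Hrel & HP & HL & Hg); auto.
    { intros i Hi; apply app_nth1; lia. }
    destruct (Hw (fun k => Z1 (3 * k + 3)) (2 * n) I1 Z1) as (I2 & Z2 & He2).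
    + repeat split; auto.
    + intros i Hi; rewrite Hg by (fold n; lia).
      rewrite app_nth2 by (fold n; lia); fold n.
      unfold ys; rewrite nth_indep with (d' := f 0) by (rewrite length_map, length_seq; lia).
      rewrite map_nth, seq_nth by lia; unfold f; f_equal.
      replace (n + 1 + (3 * (2 * n + i) + 3 - 1 - n) - (6 * n + 3)) with (i * 3) by lia.
      apply Nat.div_mul; lia.
    + exists I2, Z2; econstructor; eassumption.
  - destruct H as (y0 & ys & H); apply machine_of_halts in H as (I' & Z' & He).
    inversion He as [| | | | | |? ? ? ? I1 Z1 ? ? He1 He2| | | | | |]; subst.
    eapply wp_exec in He1; [|apply wp_init with (x := x0 :: xs) (d := d); auto].
    + destruct He1 as (Hrel & HP & HL & _).
      (* Here [g] is read off the registers [3 * k + 3] as [init] leaves them, whether they hold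
         guesses, remains of the input copy or the default. *)
      eapply exec_main_loop; [|exact He2].
      split; [exact Hrel | split; [intros; reflexivity | split; [exact HP | exact HL]]].
    + intros i Hi; apply app_nth1; lia.
Qed.

End Main.

Theorem mainTheorem1 (A : structure) (Q : list (U A) -> Prop) (HQ : SDEC A Q) :
  forall P : list (U A) -> Prop, SDEC_nu A Q P -> SDEC_ND A P.
Proof.
  intros P (M & HM & HP); destruct HQ as (MQ & HMQ & HQx).
  destruct (fixed_le_exists (prog M)) as [KM HKM].
  destruct (fixed_le_exists (prog MQ)) as [KQ HKQ].
  exists (nd_machine M MQ KM KQ); split.
  - now apply nd_machine_wf.
  - intros x; rewrite HP; now apply nd_machine_correct.
Qed.
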